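(* Let $(M,g)$ be a closed Riemannian manifold of dimension $n$, let $p\in M$, and let $U_p$ be a normal geodesic neighborhood of $p$. Let $P\in \mathrm{Diff}(M,\Lambda T^*M)$ be a differential operator which is geometric with respect to the metric $g$ and has Agmon angle $\theta$. If $P$ is rescalable at $p$, then $$\widetilde\omega^{\rm Res}_{\log_\theta(P)}(p)=\widetilde\omega^{\rm Res}_{\log_\theta(\widetilde{\mathbb P}^{\lim})}(x)\qquad\text{for all }x\in U_p,$$ where $\widetilde{\mathbb P}^{\lim}:=\lim_{\lambda\to0}\widetilde{\mathbb P}^{\rm Ge}_\lambda$. (Both sides are multiples of $dx^1\wedge\dots\wedge dx^n$; the equality is between their coefficients.)
   Context: **Coordinates and contractions.** Fix an orthonormal basis $e_1(p),\dots,e_n(p)$ of $T_pM$, a small ball $B_r\subset T_pM$ and $U_p=\exp_p(B_r)$, with normal geodesic coordinates $x=(x^1,\dots,x^n)\leftrightarrow\exp_p(\sum_i x^ie_i(p))$. For $0<\lambda<1$ let $\mathfrak f_\lambda:U_p\to\exp_p(B_{\lambda r})$, $\exp_p(\mathbf x)\mapsto\exp_p(\lambda\mathbf x)$, i.e. $x\mapsto\lambda x$ in coordinates. **Operators.** $\Lambda T^*M$ (complexified where needed) is trivialised over $U_p$ by the $dx^I$. For a multi-index $\gamma=\{i_1,\dots,i_s\}$, $D^\gamma=\partial_{x^{i_1}}\cdots\partial_{x^{i_s}}$ acts componentwise, and an operator of order $m$ is written $P=\sum_{|\gamma|\le m}P_\gamma D^\gamma$ with $P_\gamma(x)\in\mathrm{End}(\Lambda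 T_x^*M)$. **Vielbeins and geometric operators.** Let $e_1(\cdot,g),\dots,e_n(\cdot,g)$ be the orthonormal frame on $U_p$ obtained from $(e_i(p))$ by Levi-Civita parallel transport along the geodesics $t\mapsto\exp_p(t\mathbf x)$. The vielbeins $a_i^l(\cdot,g)$, $b_l^i(\cdot,g)$ are defined by $\partial_{x^i}=\sum_l a_i^l e_l$, $e_l=\sum_j b_l^j\partial_{x^j}$. A geometric polynomial of Gilkey order $N$ is a constant-coefficient linear combination of finite products of factors $D^{\beta}a_i^t(\cdot,g)$ and $D^{\gamma}b_n^l(\cdot,g)$ whose orders of differentiation add up to $N$ in each product. $P$ of order $m$ is geometric with respect to $g$ if for every $\gamma$ the entries of $P_\gamma$ (in the frame obtained by parallel transport, or equivalently in the frame $dx^I$) are geometric polynomials of Gilkey order $m-|\gamma|$. **Rescaling.** $U_\lambda$ acts on $\Lambda^kT^*M$ as multiplication by $\lambda^{-k}$, and $U_\lambda^\sharp Q=U_\lambda QU_\lambda^{-1}$ for $Q\in \mathrm{End}(\Lambda T^*M)$, $U_\lambda^\sharp P=\sum_\gamma U_\lambda^\sharp(P_\gamma)D^\gamma$. $(\mathfrak f_\lambda^\sharp P)s:=P(s\circ\mathfrak f_\lambda^{-1})\circ\mathfrak f_\lambda$ (componentwise in the trivialisation by $dx^I$; thus $\mathfrak f_\lambda^\sharp P=\sum_\gamma\lambda^{-|\gamma|}(P_\gamma\circ\mathfrak f_\lambda)D^\gamma$). For $P$ of order $m$, $\widetilde{\mathbb P}^{\rm Ge}_\lambda:=\lambda^m\mathfrak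 f_\lambda^\sharp U_\lambda^\sharp P$ on $U_p$. $P$ is rescalable at $p$ if $\widetilde{\mathbb P}^{\rm Ge}_\lambda$ has a limit $\widetilde{\mathbb P}^{\lim}$ as $\lambda\to0$ (convergence of the coefficients on $U_p$, smoothly on compact sets). **Agmon angle and logarithm.** $P$ of order $m>0$ has Agmon angle $\theta$ if the leading symbol $\sigma_m(P)(x,\xi)$, $\xi\neq0$, has no eigenvalue on the ray $L_\theta=\{re^{i\theta}:r\ge0\}$ and there is $\varepsilon>0$ such that $P$ has no eigenvalue in $\{re^{i\alpha}:r\ge 0,|\alpha-\theta|\le\varepsilon\}$. The homogeneous symbol components of $\log_\theta P$ are determined by the local symbol of $P$ (only the leading-symbol condition is needed, so they are also defined for operators on $U_p$): with $r_{-m}=(\sigma_m(P)-\mu)^{-1}$ and $r_{-m-j}=-r_{-m}\sum_{a+b+|\alpha|=j,\,b<j}\frac{(-i)^{|\alpha|}}{\alpha!}\partial_\xi^\alpha\sigma_{m-a}(P)\,\partial_x^\alpha r_{-m-b}$ the homogeneous symbol components of $(P-\mu)^{-1}$, one puts, for $\mathrm{Re}\,z<0$, $\sigma_{mz-j}(P_\theta^z)=\frac{i}{2\pi}\int_{\Gamma_\theta}\mu_\theta^z\,r_{-m-j}\,d\mu$, where $\Gamma_\theta$ comes in from infinity along $L_\theta$ (argument $\theta$), goes clockwise around a small circle about $0$ and returns to infinity along the same ray (argument $\theta-2\pi$); this extends holomorphically to $z=0$, and $\sigma_{-j}(\log_\theta P)(x,\xi)=|\xi|^{-j}\,\partial_z\big(\sigma_{mz-j}(P_\theta^z)(x,\xi/|\xi|)\big)|_{z=0}$.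 **Local form.** $\widetilde\omega^{\rm Res}_{\log_\theta(P)}(x):=\frac1{(2\pi)^n}\int_{|\xi|=1}\big[\sigma_{-n}(\log_\theta P)(x,\xi)\,\mathbf 1_x\big]_{[n]}\,d_S\xi$, where $\mathbf 1_x\in\Lambda^0T_x^*M$ is the constant $1$, $[\cdot]_{[n]}$ is the degree-$n$ part, $|\xi|$ is the Euclidean norm in the coordinates dual to $x^1,\dots,x^n$, and $d_S\xi$ is the standard volume form on the unit sphere. *)

(* Defs.v *)
From HB Require Import structures.
From mathcomp Require Import all_boot all_order all_algebra.
From mathcomp Require Import complex.
From mathcomp Require Import all_classical all_reals all_analysis.

Set Implicit Arguments.
Unset Strict Implicit.
Unset Printing Implicit Defensive.

Import Order.TTheory GRing.Theory Num.Theory.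
Import numFieldNormedType.Exports.

Local Open Scope classical_set_scope.
Local Open Scope ring_scope.
Local Open Scope complex_scope.

(* Covectors, coordinates and tangent components are all row vectors of R^n.
   Lambda(C^n) has the basis dx^I, I : {set 'I_n}; its vectors are columns and
   its endomorphisms square matrices, the coordinate of dx^I being number
   [ix I]. *)
Notation ext_dim n := #|{: {set 'I_n}}|.

Definition ix n (I : {set 'I_n}) : 'I_(ext_dim n) := enum_rank I.

Definition multiindex n := {ffun 'I_n -> nat}.

Definition mdeg n (c : multiindex n) : nat := (\sum_i c i)%N.

(* Bounded multi-indices, used as ranges of finite sums. *)
Definition mi_of n k (c : {ffun 'I_n -> 'I_k}) : multiindex n :=
  [ffun i => nat_of_ord (c i)].

Section Calculus.
Variables (R : realType) (n : nat).
Local Notation C := R[i].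
Local Notation E := 'rV[R]_n.

Definition enorm (x : E) : R := Num.sqrt (\sum_i x 0 i ^+ 2).

Definition eball (r : R) : set E := [set x | enorm x < r].

Definition pd (i : 'I_n) (f : E -> R) : E -> R :=
  fun x => 'D_(delta_mx 0 i : E) f x.

Definition pds (s : seq 'I_n) (f : E -> R) : E -> R := foldr pd f s.

Definition pdm (c : multiindex n) (f : E -> R) : E -> R :=
  pds (flatten [seq nseq (c i) i | i <- enum 'I_n]) f.

Definition pdmC (c : multiindex n) (f : E -> C) : E -> C :=
  fun x => pdm c (fun y => complex.Re (f y)) x
           +i* pdm c (fun y => complex.Im (f y)) x.

Definition pdmM k l (c : multiindex n) (f : E -> 'M[C]_(k, l)) :
    E -> 'M[C]_(k, l) :=
  fun x => \matrix_(i, j) pdmC c (fun y => f y i j) x.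

Definition smooth_on (U : set E) (f : E -> R) : Prop :=
  forall s x, U x -> differentiable (pds s f) x.

Definition smoothC_on (U : set E) (f : E -> C) : Prop :=
  smooth_on U (fun x => complex.Re (f x)) /\
  smooth_on U (fun x => complex.Im (f x)).

(* The minor with rows I and columns J, enumerated increasingly. *)
Definition minor (A : 'M[R]_n) (I J : {set 'I_n}) : R :=
  match #|I| =P #|J| with
  | ReflectT e =>
      \det (\matrix_(k, l) A (enum_val k) (enum_val (cast_ord e l)))
  | ReflectF _ => 0
  end.

End Calculus.

Section Manifold.
Variables (R : realType) (n : nat).
Local Notation C := R[i].
Local Notation E := 'rV[R]_n.

Record chart (M : topologicalType) := Chart {
  dom : set M;
  to_coord : M -> E;
  of_coord : E -> M;
  dom_open : open dom;
  img_open : open (to_coord @` dom);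
  to_coordK : forall q, dom q -> of_coord (to_coord q) = q;
  to_coord_cont : forall q, dom q -> {for q, continuous to_coord};
  of_coord_cont : forall x, (to_coord @` dom) x -> {for x, continuous of_coord}
}.

Definition img M (c : chart M) : set E := to_coord c @` dom c.

Definition overlap M (c d : chart M) : set E :=
  to_coord c @` (dom c `&` dom d).

Definition transition M (c d : chart M) : E -> E :=
  fun x => to_coord d (of_coord c x).

Definition compatible M (c d : chart M) : Prop :=
  forall j, smooth_on (overlap c d) (fun x => transition c d x 0 j) /\
            smooth_on (overlap d c) (fun x => transition d c x 0 j).

(* Second countability is automatic for a compact locally Euclidean space. *)
Record closed_manifold := ClosedManifold {
  carrier :> topologicalType;
  carrier_hausdorff : hausdorff_space carrier;
  carrier_compact : compact [set: carrier];
  atlas : set (chart carrier);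
  atlas_cover : forall q : carrier, exists2 c, atlas c & dom c q;
  atlas_compatible : forall c d, atlas c -> atlas d -> compatible c d;
  atlas_maximal : forall c, (forall d, atlas d -> compatible c d) -> atlas c
}.

Variable X : closed_manifold.

(* (metric_at c x) i j is g(d_i, d_j) at the point of coordinates x in the
   chart c.  With the library's row convention, ('J f x) i j = d_i f^j. *)
Record riemannian_metric := RiemannianMetric {
  metric_at :> chart X -> E -> 'M[R]_n;
  metric_smooth : forall c, atlas c ->
    forall i j, smooth_on (img c) (fun x => metric_at c x i j);
  metric_sym : forall c, atlas c ->
    forall x, img c x -> (metric_at c x)^T = metric_at c x;
  metric_pos : forall c, atlas c -> forall x, img c x ->
    forall v : E, v != 0 -> 0 < (v *m metric_at c x *m v^T) 0 0;
  metric_change : forall c d, atlas c -> atlas d -> forall x, overlap c d x ->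
    metric_at c x = 'J (transition c d) x
                    *m metric_at d (transition c d x)
                    *m ('J (transition c d) x)^T
}.

(* Smooth sections of Lambda T^*M (x) C, by components in the frames dx^I:
   if y = transition c d x then dy^I = sum_J det(d y^I / d x^J) dx^J. *)
Record form := Form {
  form_at :> chart X -> E -> 'cV[C]_(ext_dim n);
  form_smooth : forall c, atlas c ->
    forall I, smoothC_on (img c) (fun x => form_at c x I 0);
  form_change : forall c d, atlas c -> atlas d -> forall x, overlap c d x ->
    forall J, form_at c x (ix J) 0 =
      \sum_(I : {set 'I_n}) (minor ('J (transition c d) x) J I)%:C
                            * form_at d (transition c d x) (ix I) 0
}.

(* The coefficients P_gamma of a differential operator in a fixed chart; only
   those with |gamma| <= m are relevant for an operator of order m. *)
Definition local_op := multiindex n -> E -> 'M[C]_(ext_dim n).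

Definition smooth_coefs m (U : set E) (P : local_op) : Prop :=
  forall c, (mdeg c <= m)%N -> forall I J, smoothC_on U (fun x => P c x I J).

Definition apply_op m (P : local_op) (s : E -> 'cV[C]_(ext_dim n)) :
    E -> 'cV[C]_(ext_dim n) :=
  fun x => \sum_(c : {ffun 'I_n -> 'I_m.+1} | (mdeg (mi_of c) <= m)%N)
             P (mi_of c) x *m pdmM (mi_of c) s x.

Record diff_op (m : nat) := DiffOp {
  op :> form -> form;
  coef : chart X -> local_op;
  coef_smooth : forall c, atlas c -> smooth_coefs m (img c) (coef c);
  op_local : forall w c, atlas c -> forall x, img c x ->
    op w c x = apply_op m (coef c) (w c) x
}.

Definition op_eigenvalue m (P : diff_op m) (mu : C) : Prop :=
  exists w : form,
    (exists c x, [/\ atlas c, img c x & w c x != 0]) /\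
    (forall c, atlas c -> forall x, img c x -> P w c x = mu *: w c x).

End Manifold.

Section Geodesics.
Variables (R : realType) (n : nat) (X : closed_manifold R n).
Variable g : riemannian_metric X.
Local Notation E := 'rV[R]_n.

(* Gamma^k_{ij} in the chart c. *)
Definition christoffel (c : chart R n X) (x : E) (k i j : 'I_n) : R :=
  2^-1 * \sum_l invmx (g c x) k l *
    (pd i (fun y => g c y j l) x + pd j (fun y => g c y i l) x
     - pd l (fun y => g c y i j) x).

(* Complete geodesics; every geodesic of a closed manifold extends to one. *)
Definition geodesic (c : R -> X) : Prop :=
  continuous c /\
  forall d, atlas d -> forall t, dom d (c t) ->
  let y k := fun s => to_coord d (c s) 0 k in
  forall k, [/\ derivable (y k) t 1, derivable (derive1 (y k)) t 1 &
    derive1 (derive1 (y k)) t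
    + \sum_i \sum_j christoffel d (to_coord d (c t)) k i j
                    * derive1 (y i) t * derive1 (y j) t = 0].

(* q = exp_p(v), with v given by its components in the chart d around p. *)
Definition is_exp (d : chart R n X) (p : X) (v : E) (q : X) : Prop :=
  exists c : R -> X, [/\ geodesic c, c 0 = p,
    forall k, derive1 (fun s => to_coord d (c s) 0 k) 0 = v 0 k & c 1 = q].

(* The rows of e are the components in d of an orthonormal basis of T_pM. *)
Definition orthonormal_basis (d : chart R n X) (p : X) (e : 'M[R]_n) : Prop :=
  [/\ atlas d, dom d p & e *m g d (to_coord d p) *m e^T = 1%:M].

(* u is the chart exp_p(sum_i x^i e_i) |-> x of U_p = dom u = exp_p(B_r). *)
Definition normal_chart (d : chart R n X) (p : X) (e : 'M[R]_n) (r : R)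
    (u : chart R n X) : Prop :=
  [/\ 0 < r, atlas u, img u = eball r, dom u p /\ to_coord u p = 0 &
      forall x, eball r x -> is_exp d p (x *m e) (of_coord u x)].

(* e_l = sum_j b_l^j d_j and d_i = sum_l a_i^l e_l, where the frame (e_l) is
   parallel along the curves t |-> t x of the normal chart u, and e_l(p) is the
   l-th vector of the basis e, whose components in d are converted to u. *)
Definition vielbeins (d : chart R n X) (p : X) (e : 'M[R]_n) (r : R)
    (u : chart R n X) (a b : E -> 'M[R]_n) : Prop :=
  [/\ b 0 = e *m 'J (transition d u) (to_coord d p),
      forall (x : E) (t : R), eball r x -> 0 <= t <= 1 -> forall l k,
        is_derive t 1 (fun s => b (s *: x) l k)
          (- \sum_i \sum_j christoffel u (t *: x) k i j
                           * x 0 i * b (t *: x) l j) &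
      forall x, eball r x -> a x *m b x = 1%:M].

End Geodesics.

Section Geometric.
Variables (R : realType) (n : nat).
Local Notation C := R[i].
Local Notation E := 'rV[R]_n.
Variables a b : E -> 'M[R]_n.

Inductive gilkey_monomial : nat -> (E -> R) -> Prop :=
| gilkey_one : gilkey_monomial 0 (fun=> 1)
| gilkey_a c i t N f : gilkey_monomial N f ->
    gilkey_monomial (mdeg c + N) (fun x => pdm c (fun y => a y i t) x * f x)
| gilkey_b c l j N f : gilkey_monomial N f ->
    gilkey_monomial (mdeg c + N) (fun x => pdm c (fun y => b y l j) x * f x).

Definition gilkey_polynomial (N : nat) (f : E -> C) : Prop :=
  exists k (z : 'I_k -> C) (h : 'I_k -> E -> R),
    (forall i, gilkey_monomial N (h i)) /\
    (forall x, f x = \sum_i z i * (h i x)%:C).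

Definition geometric_op (m : nat) (U : set E) (P : local_op R n) : Prop :=
  forall c, (mdeg c <= m)%N -> forall I J,
  exists f, gilkey_polynomial (m - mdeg c) f /\ (forall x, U x -> P c x I J = f x).

End Geometric.

Section Rescaling.
Variables (R : realType) (n : nat).
Local Notation C := R[i].
Local Notation E := 'rV[R]_n.
Local Notation EndL := 'M[C]_(ext_dim n).

Definition U_mx (lam : R) : EndL :=
  diag_mx (\row_k (lam ^- #|(enum_val k : {set 'I_n})|)%:C).

Definition U_sharp (lam : R) (P : local_op R n) : local_op R n :=
  fun c x => U_mx lam *m P c x *m invmx (U_mx lam).

Definition f_sharp (lam : R) (P : local_op R n) : local_op R n :=
  fun c x => (lam ^- mdeg c)%:C *: P c (lam *: x).

Definition rescaled (m : nat) (lam : R) (P : local_op R n) : local_op R n :=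
  fun c x => (lam ^+ m)%:C *: f_sharp lam (U_sharp lam P) c x.

(* The coefficients of [rescaled m lam P] tend to those of L as lam -> 0+,
   uniformly with all derivatives on the compact subsets of U. *)
Definition rescaling_limit (m : nat) (U : set E) (P L : local_op R n) : Prop :=
  smooth_coefs m U L /\
  forall c al, (mdeg c <= m)%N -> forall K, compact K -> K `<=` U ->
  forall I J (eps : R), 0 < eps ->
  \forall lam \near 0^'+, forall x, K x ->
    `| pdmC al (fun y => rescaled m lam P c y I J) x
       - pdmC al (fun y => L c y I J) x | < eps%:C.

End Rescaling.

Section LogSymbol.
Variables (R : realType) (n : nat).
Local Notation C := R[i].
Local Notation E := 'rV[R]_n.
Local Notation EndL := 'M[C]_(ext_dim n).
Variables (m : nat) (P : local_op R n).

(* sigma_{m-a}(P)(x, xi); it is 0 for a > m.  D^gamma is a product of partial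
   derivatives without factors -i, so its symbol is (i xi)^gamma. *)
Definition symb (a : nat) (x xi : E) : EndL :=
  \sum_(c : {ffun 'I_n -> 'I_m.+1} | (mdeg (mi_of c) + a == m)%N)
     ('i%C ^+ mdeg (mi_of c) * (\prod_i xi 0 i ^+ c i)%:C) *: P (mi_of c) x.

(* [res_table mu j b] is r_{-m-b} for b <= j. *)
Fixpoint res_table (mu : C) (j : nat) : nat -> E -> E -> EndL :=
  match j with
  | 0 => fun _ x xi => invmx (symb 0 x xi - mu%:M)
  | j'.+1 =>
      let r := res_table mu j' in
      fun b0 => if (b0 <= j')%N then r b0 else
      fun x xi => - (r 0%N x xi *m
        \sum_(a < j'.+2) \sum_(b < j'.+1)
        \sum_(al : {ffun 'I_n -> 'I_j'.+2} | (a + b + mdeg (mi_of al) == j'.+1)%N)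
          ((- 'i%C) ^+ mdeg (mi_of al) / (\prod_i (al i)`!)%N%:R) *:
            (pdmM (mi_of al) (symb a x) xi
             *m pdmM (mi_of al) (fun y => r b y xi) x))
  end.

Definition res_symb (mu : C) (j : nat) : E -> E -> EndL := res_table mu j j.

Definition polar (r t : R) : C := (r * cos t) +i* (r * sin t).

Definition cexp (z : C) : C := polar (expR (complex.Re z)) (complex.Im z).

Definition cpow (r t : R) (z : C) : C := cexp (z * (ln r +i* t)).

Definition Cintegral (D : set R) (f : R -> C) : C :=
  (\int[lebesgue_measure]_(t in D) complex.Re (f t))
  +i* (\int[lebesgue_measure]_(t in D) complex.Im (f t)).

(* The integral of mu_theta^z h(mu) along Gamma_theta: in along the ray of
   argument th up to radius rho, clockwise on the circle of radius rho, out
   along the same ray with argument th - 2 pi. *)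
Definition contour_integral (th rho : R) (z : C) (h : C -> C) : C :=
  - Cintegral `[rho, +oo[%classic
      (fun r => cpow r th z * h (polar r th) * polar 1 th)
  - Cintegral `[th - 2 * pi, th]%classic
      (fun t => cpow rho t z * h (polar rho t) * ('i%C * polar rho t))
  + Cintegral `[rho, +oo[%classic
      (fun r => cpow r (th - 2 * pi) z * h (polar r (th - 2 * pi))
                * polar 1 (th - 2 * pi)).

Definition power_symb (th rho : R) (z : C) (j : nat) (x xi : E) : EndL :=
  \matrix_(I, J) ('i%C / (2 * pi)%:C *
    contour_integral th rho z (fun mu => res_symb mu j x xi I J)).

(* The circle is small if all eigenvalues of the leading symbol lie outside. *)
Definition small_radius (x xi : E) (rho : R) : Prop :=
  0 < rho /\ forall mu, eigenvalue (symb 0 x xi) mu -> rho%:C < `|mu|.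

(* v is the derivative at 0 of a holomorphic extension F of the (I, J) entry of
   sigma_{mz-j}(P_theta^z)(x, xi) from Re z < 0 to a neighbourhood of 0.  Such a
   v is unique: F(0) and F'(0) are limits along the negative reals, and the
   contour integral does not depend on the small radius rho. *)
Definition log_entry (th : R) (j : nat) (x xi : E) (I J : 'I_(ext_dim n))
    (v : C) : Prop :=
  exists (rho : R) (U : set C^o) (F : C^o -> C^o),
    [/\ small_radius x xi rho,
        [/\ open U, U 0 & forall z : C, complex.Re z < 0 -> U z],
        forall z : C, complex.Re z < 0 -> F z = power_symb th rho z j x xi I J,
        forall z, U z -> derivable F z 1 &
        v = 'D_1 F 0].

(* sigma_{-j}(log_theta P)(x, xi). *)
Definition log_symb (th : R) (j : nat) (x xi : E) : EndL :=
  \matrix_(I, J) ((enorm xi ^- j)%:C *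
    xget 0 (log_entry th j x ((enorm xi)^-1 *: xi) I J)).

End LogSymbol.

Section Residue.
Variable R : realType.
Local Notation C := R[i].

(* The Lebesgue integral on R^n as an iterated integral. *)
Fixpoint integral_rV (n : nat) : ('rV[R]_n -> R) -> R :=
  match n return ('rV[R]_n -> R) -> R with
  | 0 => fun f => f 0
  | k.+1 => fun f => \int[lebesgue_measure]_(t in [set: R])
                       integral_rV (fun v : 'rV_k => f (row_mx (t%:M : 'rV_1) v))
  end.

(* The surface measure of the unit sphere, as cone measure: the area of A is n
   times the Lebesgue measure of {s w | 0 < s < 1, w in A}. *)
Definition sphere_integral n (f : 'rV[R]_n -> R) : R :=
  n%:R * integral_rV (fun v : 'rV[R]_n =>
    if 0 < enorm v < 1 then f ((enorm v)^-1 *: v) else 0).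

(* The function 1 in Lambda^0. *)
Definition const_one n : 'cV[C]_(ext_dim n) := delta_mx (ix finset.set0) 0.

(* The coefficient of dx^1 /\ .. /\ dx^n. *)
Definition top_part n (w : 'cV[C]_(ext_dim n)) : C := w (ix (finset.setT : {set 'I_n})) 0.

(* The coefficient of dx^1 /\ .. /\ dx^n in omega^Res_{log_theta P}(x), for the
   operator of order m with coefficients P. *)
Definition omega_res n (m : nat) (P : local_op R n) (th : R) (x : 'rV[R]_n) : C :=
  let f xi := top_part (log_symb m P th n x xi *m const_one n) in
  ((2 * pi) ^- n)%:C *
    (sphere_integral (fun xi => complex.Re (f xi))
     +i* sphere_integral (fun xi => complex.Im (f xi))).

(* No eigenvalue of the leading symbol on L_theta, no eigenvalue of P in a
   closed sector around L_theta. *)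
Definition agmon_angle n (X : closed_manifold R n) m (P : diff_op X m) (th : R)
    : Prop :=
  (forall c, atlas c -> forall x, img c x -> forall xi, xi != 0 ->
     forall r, 0 <= r -> ~~ eigenvalue (symb m (coef P c) 0 x xi) (polar r th)) /\
  (exists2 eps : R, 0 < eps &
     forall r al, 0 <= r -> `|al - th| <= eps -> ~ op_eigenvalue P (polar r al)).

End Residue.

(* Main.v *)
Require Import Defs.
From mathcomp Require Import all_boot all_order all_algebra.
From mathcomp Require Import complex.
From mathcomp Require Import all_classical all_reals all_analysis.

Set Implicit Arguments.
Unset Strict Implicit.
Unset Printing Implicit Defensive.

Import Order.TTheory GRing.Theory Num.Theory.
Import numFieldNormedType.Exports.

Local Open Scope classical_set_scope.
Local Open Scope ring_scope.

(* Write P^lam for the rescaled operator.  Its symbol components are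
   lam^a U sigma_{m-a}(P)(lam x, xi) U^-1, so induction on the recursion for the
   resolvent gives r_{-m-j}(P^lam)(x) = lam^j U r_{-m-j}(P)(lam x) U^-1, with no
   rescaling of mu.  For j = n the entry from Lambda^0 to Lambda^n is multiplied
   by lam^n lam^-n = 1.  The resolvent symbols are polynomials in derivatives of
   the coefficients and of r_{-m}, hence they pass to the limit lam -> 0: that
   entry of r_{-m-n} is, for every mu off the spectrum, the same for P at p and
   for the limit operator at any x.  The leading symbols of the two have the same
   characteristic polynomial, so the contours and the small radii agree as well,
   and all integrals are equal integrand by integrand. *)

(** * Families of functions converging with their derivatives *)

(** The differential of [f] also serves [g]: the remainder is a little-o at 0, so it depends only on
    germs. Uniqueness of the differential then identifies ['d g x] with ['d f x]. *)
Lemma near_eq_differentiable (K : numFieldType) (V W : normedModType K)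
    (f g : V -> W) (x : V) :
  {near x, f =1 g} -> differentiable f x -> differentiable g x.
Proof.
move=> fg df; have [dfc dfE] := (diff_locallyP x f).1 df.
have gE : g \o shift x = cst (g x) + 'd f x +o_ 0 id.
  apply/eqaddoP => e e0; have /eqaddoP/(_ e e0) := dfE.
  have : \forall h \near 0, f (h + x) = g (h + x).
    have : \forall y \near x, f y = g y by [].
    by rewrite (near_shift 0); apply: filterS => h /=; rewrite subr0.
  apply: filterS2 => h /= fgh; congr (`|_| <= _).
  by rewrite !fctE /= fgh (nbhs_singleton fg).
have dgE : 'd g x = 'd f x :> (V -> W) by exact: diff_unique.
by apply/diff_locallyP; rewrite dgE.
Qed.

Section Ccvg.
Variables (R : realType) (n : nat).
Local Notation E := 'rV[R]_n.
Variables (T : Type) (Phi : set_system T).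
Context {PF : ProperFilter Phi}.
Variable U : set E.
Hypothesis Uo : open U.

(* F t -> q in C^N, pointwise on U.  A constant family converges iff its value
   is of class C^N in this sense, so each closure lemma below is also one for
   smooth functions. *)
Fixpoint ccvg (N : nat) (F : T -> E -> R) (q : E -> R) : Prop :=
  [/\ \forall t \near Phi, forall x, U x -> differentiable (F t) x,
      forall x, U x -> differentiable q x,
      forall x, U x -> F ^~ x @ Phi --> q x &
      match N with
      | 0 => True
      | N'.+1 => forall i, ccvg N' (fun t => pd i (F t)) (pd i q)
      end].

Definition smcvg F q := forall N, ccvg N F q.

Lemma ccvg_diff N F q x : ccvg N F q -> U x -> differentiable q x.
Proof. by case: N => [|N] [_ dq _ _]; apply: dq. Qed.

Lemma ccvg_cvg N F q x : ccvg N F q -> U x -> F ^~ x @ Phi --> q x.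
Proof. by case: N => [|N] [_ _ cq _]; apply: cq. Qed.

Lemma ccvgW N F q : ccvg N.+1 F q -> ccvg N F q.
Proof.
elim: N F q => [|N IH] F q [d1 d2 c]; first by move=> _; split.
by move=> H; split => // i; apply: IH; apply: H.
Qed.

Lemma near_open x : U x -> \forall y \near x, U y.
Proof. by move=> Ux; apply: open_nbhs_nbhs. Qed.

Lemma pd_eq_in (f g : E -> R) i :
  (forall x, U x -> f x = g x) -> forall x, U x -> pd i f x = pd i g x.
Proof.
move=> fg x Ux; apply: near_eq_derive.
by apply: filterS (near_open Ux) => y /fg.
Qed.

Lemma differentiable_eq_in (f g : E -> R) :
  (forall x, U x -> f x = g x) -> forall x, U x -> differentiable f x ->
  differentiable g x.
Proof.
move=> fg x Ux; apply: near_eq_differentiable.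
by apply: filterS (near_open Ux) => y /fg.
Qed.

(** Since [U] is open, derivatives at its points depend only on values in [U], so equality there is
    inherited by all partial derivatives. *)
Lemma ccvg_ext N F F' q q' :
  (\forall t \near Phi, forall x, U x -> F t x = F' t x) ->
  (forall x, U x -> q x = q' x) -> ccvg N F q -> ccvg N F' q'.
Proof.
elim: N F F' q q' => [|N IH] F F' q q' FF qq; case=> d1 d2 c H; split => //;
  try (by apply: filterS2 FF d1 => t FFt dt x Ux;
     apply: (differentiable_eq_in FFt) (dt x Ux));
  try (by move=> x Ux; apply: (differentiable_eq_in qq) (d2 x Ux));
  try (by move=> x Ux; rewrite -(qq x Ux); apply: cvg_trans (c x Ux);
     apply: near_eq_cvg; apply: filterS FF => t; apply).
move=> i; apply: IH (H i); last exact: pd_eq_in.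
by apply: filterS FF => t; apply: pd_eq_in.
Qed.

Lemma ccvg_pd N i F q :
  ccvg N.+1 F q -> ccvg N (fun t => pd i (F t)) (pd i q).
Proof. by case=> _ _ _; apply. Qed.

Lemma smcvg_pd i F q : smcvg F q -> smcvg (fun t => pd i (F t)) (pd i q).
Proof. by move=> H N; apply: ccvg_pd (H N.+1). Qed.

Lemma ccvg_cst N (k : R) : ccvg N (fun _ _ => k) (fun=> k).
Proof.
elim: N k => [|N IH] k; split => //.
- by apply: nearW => _ x _; exact: differentiable_cst.
- by move=> x _; exact: cvg_cst.
- by apply: nearW => _ x _; exact: differentiable_cst.
- by move=> x _; exact: cvg_cst.
move=> i; apply: ccvg_ext (IH 0) => [|x _]; last by rewrite /pd derive_cst.
by apply: nearW => t x _; rewrite /pd derive_cst.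
Qed.

Lemma ccvgD N F q G h : ccvg N F q -> ccvg N G h ->
  ccvg N (fun t x => F t x + G t x) (fun x => q x + h x).
Proof.
elim: N F q G h => [|N IH] F q G h [dF dq cF HF] [dG dh cG HG]; split => //;
  try (by apply: filterS2 dF dG => t dFt dGt x Ux; apply: differentiableD; auto);
  try (by move=> x Ux; apply: differentiableD; auto);
  try (by move=> x Ux; apply: cvgD; auto).
move=> i; apply: ccvg_ext (IH _ _ _ _ (HF i) (HG i)).
  apply: filterS2 dF dG => t dFt dGt x Ux.
  by rewrite /pd -deriveD//; apply: diff_derivable; auto.
by move=> x Ux; rewrite /pd -deriveD//; apply: diff_derivable; auto.
Qed.

(** Leibniz rule: each term of a derivative keeps one undifferentiated factor, which [ccvgW] lowers
    to the order of the induction hypothesis. *)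
Lemma ccvgM N F q G h : ccvg N F q -> ccvg N G h ->
  ccvg N (fun t x => F t x * G t x) (fun x => q x * h x).
Proof.
elim: N F q G h => [|N IH] F q G h HF HG;
  move: (HF) (HG) => [dF dq cF dF'] [dG dh cG dG']; split => //;
  try (by apply: filterS2 dF dG => t dFt dGt x Ux; apply: differentiableM; auto);
  try (by move=> x Ux; apply: differentiableM; auto);
  try (by move=> x Ux; apply: cvgM; auto).
move=> i; have := ccvgD (IH _ _ _ _ (ccvgW HF) (dG' i))
  (IH _ _ _ _ (ccvgW HG) (dF' i)).
apply: ccvg_ext.
  apply: filterS2 dF dG => t dFt dGt x Ux.
  by rewrite /pd -[RHS]/('D_ _ (F t * G t) x) deriveM//;
    apply: diff_derivable; auto.
by move=> x Ux; rewrite /pd -[RHS]/('D_ _ (q * h) x) deriveM//;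
  apply: diff_derivable; auto.
Qed.

(** The derivative of 1/F is -F^-2 times that of F, a product of families already known to converge
    to order N. *)
Lemma ccvgV N F q : (\forall t \near Phi, forall x, U x -> F t x != 0) ->
  (forall x, U x -> q x != 0) -> ccvg N F q ->
  ccvg N (fun t x => (F t x)^-1) (fun x => (q x)^-1).
Proof.
move=> F0 q0; elim: N => [|N IH] HF; move: (HF) => [dF dq cF dF']; split => //;
  try (by apply: filterS2 dF F0 => t dFt F0t x Ux; apply: differentiableV; auto);
  try (by move=> x Ux; apply: differentiableV; auto);
  try (by move=> x Ux; apply: cvgV; auto).
have {}IH := IH (ccvgW HF).
move=> i; have := ccvgM (ccvg_cst N (-1)) (ccvgM (ccvgM IH IH) (dF' i)).
apply: ccvg_ext.
  apply: filterS2 dF F0 => t dFt F0t x Ux.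
  rewrite /pd [RHS]deriveV ?F0t//; last first.
    by apply: diff_derivable; auto.
  by rewrite mulN1r -exprVn expr2 scaleNr.
move=> x Ux; rewrite /pd [RHS]deriveV ?q0//; last first.
  by apply: diff_derivable; auto.
by rewrite mulN1r -exprVn expr2 scaleNr.
Qed.

Lemma smcvg_pds s F q : smcvg F q -> smcvg (fun t => pds s (F t)) (pds s q).
Proof. by move=> H; elim: s => //= i s IH; apply: smcvg_pd. Qed.

Lemma smcvgP F q :
  (\forall t \near Phi, smooth_on U (F t)) -> smooth_on U q ->
  (forall s x, U x -> (fun t => pds s (F t) x) @ Phi --> pds s q x) ->
  smcvg F q.
Proof.
move=> sF sq cF N; elim: N F q sF sq cF => [|N IH] F q sF sq cF; split => //;
  try (by apply: filterS sF => t sFt x Ux; apply: (sFt [::]));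
  try (by move=> x; apply: (sq [::]));
  try (by move=> x; apply: (cF [::])).
(* [ccvg] takes off the innermost derivative, which is the last entry of the list. *)
have pdsr i s f : pds s (pd i f) = pds (rcons s i) f.
  by rewrite /pds foldr_rcons.
move=> i; apply: IH.
- by apply: filterS sF => t sFt s x Ux; rewrite pdsr; apply: sFt.
- by move=> s x Ux; rewrite pdsr; apply: sq.
- move=> s x Ux; rewrite pdsr; apply: cvg_trans (cF (rcons s i) x Ux).
  by apply: near_eq_cvg; apply: nearW => t; rewrite pdsr.
Qed.

Lemma smcvg_smooth F q : smcvg F q -> smooth_on U q.
Proof. by move=> H s x; apply: ccvg_diff (smcvg_pds s H 0%N). Qed.

End Ccvg.

(** * Mixed partial derivatives and dilations *)

Section MixedPartials.
Variables (R : realType) (V : normedModType R).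
Implicit Types (f : V -> R) (x v w : V).

Lemma is_derive_line f x v (t : R) : derivable f (x + t *: v) v ->
  is_derive t 1 (fun s => f (x + s *: v)) ('D_v f (x + t *: v)).
Proof.
have E : (fun h : R => h^-1 *: (((fun s : R => f (x + s *: v)) \o shift t)
    (h *: 1) - f (x + t *: v)))
  = (fun h : R => h^-1 *: ((f \o shift (x + t *: v)) (h *: v)
    - f (x + t *: v))).
  apply/funext => h; rewrite /= [h *: 1]mulr1 scalerDl.
  by congr (_ *: (f _ - _)); rewrite addrCA.
by move=> df; apply: DeriveDef; rewrite /derivable /derive E.
Qed.

(** The two difference quotients are the same function of h. *)
Lemma derive_precomp_scale f x v (k : R) :
  'D_v (fun y => f (k *: y)) x = 'D_(k *: v) f (k *: x).
Proof.
have E : (fun h : R => h^-1 *: (((fun y => f (k *: y)) \o shift x) (h *: v)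
    - f (k *: x)))
  = (fun h : R => h^-1 *: ((f \o shift (k *: x)) (h *: (k *: v)) - f (k *: x))).
  apply/funext => h /=; congr (_ *: (f _ - _)).
  by rewrite scalerDr !scalerA [h * k]mulrC.
by rewrite /derive E.
Qed.

(** The mean value theorem is applied twice, first along v to the increment of f in the direction w,
    then along w to the derivative of f in the direction v. *)
Lemma second_difference f x v w (h : R) : 0 < h ->
  (forall s t, 0 <= s <= h -> 0 <= t <= h ->
     differentiable f (x + s *: v + t *: w) /\
     differentiable ('D_v f) (x + s *: v + t *: w)) ->
  exists s t, [/\ 0 <= s <= h, 0 <= t <= h &
    f (x + h *: v + h *: w) - f (x + h *: v) - (f (x + h *: w) - f x)
      = 'D_w ('D_v f) (x + s *: v + t *: w) * h ^+ 2].
Proof.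
move=> h0 df.
have hh : 0 <= h <= h by rewrite lexx ltW.
have h00 : 0 <= (0 : R) <= h by rewrite lexx ltW.
pose G (s : R) := f (x + h *: w + s *: v) - f (x + s *: v).
have dG s : s \in `[0, h] -> is_derive s 1 G
    ('D_v f (x + s *: v + h *: w) - 'D_v f (x + s *: v)).
  rewrite in_itv /= => sh; apply: is_deriveB; last first.
    apply: is_derive_line; apply: diff_derivable.
    by have [+ _] := df s 0 sh h00; rewrite scale0r addr0.
  rewrite addrAC; apply: is_derive_line; apply: diff_derivable.
  by have [+ _] := df s h sh hh; rewrite addrAC.
have [s sh EG] : exists2 s, s \in `[0, h] &
    G h - G 0 = ('D_v f (x + s *: v + h *: w) - 'D_v f (x + s *: v)) * (h - 0).
  have H1 z : z \in `]0, h[ -> is_derive z 1 G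
      ('D_v f (x + z *: v + h *: w) - 'D_v f (x + z *: v)).
    by move=> /subset_itv_oo_cc; apply: dG.
  have H2 : {within `[0, h], continuous G}.
    by apply: derivable_within_continuous => z /dG[].
  exact: (MVT_segment (ltW h0) H1 H2).
have dH t : t \in `[0, h] ->
    is_derive t 1 (fun t => 'D_v f (x + s *: v + t *: w))
      ('D_w ('D_v f) (x + s *: v + t *: w)).
  rewrite in_itv /= => th; apply: is_derive_line; apply: diff_derivable.
  by have [] := df s t sh th.
have [t th EH] : exists2 t, t \in `[0, h] &
    'D_v f (x + s *: v + h *: w) - 'D_v f (x + s *: v + 0 *: w)
    = 'D_w ('D_v f) (x + s *: v + t *: w) * (h - 0).
  have H1 z : z \in `]0, h[ -> is_derive z 1 (fun t => 'D_v f (x + s *: v + t *: w))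
      ('D_w ('D_v f) (x + s *: v + z *: w)).
    by move=> /subset_itv_oo_cc; apply: dH.
  have H2 : {within `[0, h], continuous (fun t => 'D_v f (x + s *: v + t *: w))}.
    by apply: derivable_within_continuous => z /dH[].
  exact: (MVT_segment (ltW h0) H1 H2).
exists s, t; split => //.
move: EG; rewrite -[X in _ - 'D_v f X]addr0 -(scale0r w) EH subr0 /G.
by rewrite !scale0r !addr0 expr2 mulrA => <-; rewrite [x + h *: w + _]addrAC.
Qed.

Let dist_le_of_near (a b c d e : R) :
  b = c -> `|a - b| < e / 2 -> `|d - c| < e / 2 -> `|a - d| <= e.
Proof.
move=> -> ac dc; rewrite -(subrKA c) (le_trans (ler_normD _ _))// [e]splitr.
by rewrite lerD// ltW// distrC.
Qed.

Let eq_of_differences (a b c d p q k : R) :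
  k != 0 -> a - b - (c - d) = p * k -> a - c - (b - d) = q * k -> p = q.
Proof.
move=> k0 E1 E2; apply: (mulIf k0); rewrite -E1 -E2 !opprB.
by rewrite [LHS]addrACA [RHS]addrACA; congr (_ + _); rewrite addrC.
Qed.

(** Schwarz's theorem: one second difference over a small parallelogram is a value of A and also a
    value of B times h^2, both near x. Continuity at x brings both values close to A x and B x. *)
Lemma derive_swap f x v w :
  (\forall y \near x, [/\ differentiable f y, differentiable ('D_v f) y &
     differentiable ('D_w f) y]) ->
  {for x, continuous ('D_w ('D_v f))} -> {for x, continuous ('D_v ('D_w f))} ->
  'D_w ('D_v f) x = 'D_v ('D_w f) x.
Proof.
move=> df cA cB; set A := 'D_w ('D_v f) in cA *; set B := 'D_v ('D_w f) in cB *.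
apply/eqP; rewrite -subr_eq0 -normr_eq0; apply/eqP/le_anti.
rewrite normr_ge0 andbT; apply/ler_addgt0Pr => e e0; rewrite add0r.
have e2 : 0 < e / 2 by rewrite divr_gt0.
have nA : \forall y \near x, `|A x - A y| < e / 2.
  by move/cvgrPdist_lt: cA; apply.
have nB : \forall y \near x, `|B x - B y| < e / 2.
  by move/cvgrPdist_lt: cB; apply.
have /nbhs_ballP[d /= d0 Hd] : \forall y \near x,
    [/\ differentiable f y, differentiable ('D_v f) y & differentiable ('D_w f) y]
    /\ (`|A x - A y| < e / 2 /\ `|B x - B y| < e / 2).
  by apply: filterI df (filterI nA nB).
(* The summand 1 keeps N positive when v = w = 0. With h = d / (2 N) the parallelogram of sides h v
   and h w at x stays in the ball of radius d. *)
pose N := `|v| + `|w| + 1.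
have N0 : 0 < N by rewrite ltr_wpDl// addr_ge0.
pose h := d / (2 * N).
have h0 : 0 < h by rewrite divr_gt0// mulr_gt0.
have Hb s t : 0 <= s <= h -> 0 <= t <= h -> ball x d (x + s *: v + t *: w).
  move=> /andP[s0 sh] /andP[t0 th]; rewrite -ball_normE /= -addrA opprD addrA.
  rewrite subrr sub0r normrN (le_lt_trans (ler_normD _ _))// !normrZ !ger0_norm//.
  apply: (@le_lt_trans _ _ (h * N)).
    by rewrite /N !mulrDr mulr1 ler_wpDr ?(ltW h0)// lerD// ler_wpM2r.
  rewrite /h invfM mulrA -mulrA mulVf ?gt_eqF// mulr1.
  by rewrite ltr_pdivrMr// ltr_pMr// ltr1n.
have [s [t [sh th E1]]] := second_difference h0 (fun s t sh th =>
  let: conj (And3 a b _) _ := Hd _ (Hb s t sh th) in conj a b).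
have Hb' s' t' : 0 <= s' <= h -> 0 <= t' <= h -> ball x d (x + s' *: w + t' *: v).
  by move=> ? ?; rewrite addrAC; apply: Hb.
have [s' [t' [sh' th' E2]]] := second_difference h0 (fun s t sh th =>
  let: conj (And3 a _ b) _ := Hd _ (Hb' s t sh th) in conj a b).
have EAB : A (x + s *: v + t *: w) = B (x + s' *: w + t' *: v).
  have h20 : h ^+ 2 != 0 by rewrite expf_neq0// gt_eqF.
  rewrite (addrAC x (h *: w)) in E2.
  exact: eq_of_differences h20 E1 E2.
have [_ [/= nA1 _]] := Hd _ (Hb s t sh th).
have [_ [/= _ nB1]] := Hd _ (Hb' s' t' sh' th').
exact: dist_le_of_near EAB nA1 nB1.
Qed.

End MixedPartials.

Section Pds.
Variables (R : realType) (n : nat).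
Local Notation E := 'rV[R]_n.
Variable U : set E.
Hypothesis Uo : open U.
Implicit Types (f g : E -> R) (s : seq 'I_n).

Lemma pds_cat s1 s2 f : pds (s1 ++ s2) f = pds s1 (pds s2 f).
Proof. by rewrite /pds foldr_cat. Qed.

Lemma pds_eq_in s f g : (forall x, U x -> f x = g x) ->
  forall x, U x -> pds s f x = pds s g x.
Proof. by move=> fg; elim: s => //= i s IH; apply: pd_eq_in. Qed.

Lemma smooth_pds s f : smooth_on U f -> smooth_on U (pds s f).
Proof. by move=> sf s' x Ux; rewrite -pds_cat; apply: sf. Qed.

Lemma pd_swap i j f x : smooth_on U f -> U x ->
  pd i (pd j f) x = pd j (pd i f) x.
Proof.
move=> sf Ux; apply: derive_swap.
- apply: filterS (near_open Uo Ux) => y Uy.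
  by split; [exact: (sf [::]) | exact: (sf [:: j]) | exact: (sf [:: i])].
- by apply: differentiable_continuous; exact: (sf [:: i; j]).
- by apply: differentiable_continuous; exact: (sf [:: j; i]).
Qed.

Lemma pds_front i s2 s3 f : smooth_on U f ->
  forall x, U x -> pds (s2 ++ i :: s3) f x = pds (i :: s2 ++ s3) f x.
Proof.
move=> sf; elim: s2 => //= j s2 IH x Ux.
rewrite (pd_eq_in Uo j IH Ux) /= pd_swap//.
exact: smooth_pds.
Qed.

(** The head of [s] occurs in [s']; [pds_front] moves that occurrence to the front, and the tails
    are handled by induction. *)
Lemma pds_perm s s' f : smooth_on U f -> perm_eq s s' ->
  forall x, U x -> pds s f x = pds s' f x.
Proof.
move=> sf; elim: s s' => [|i s IH] s' ss' x Ux.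
  by rewrite perm_sym in ss'; rewrite (perm_nilP ss').
have : i \in s' by rewrite -(perm_mem ss') mem_head.
move=> is'; case/splitPr: is' ss' => s2 s3 ss'.
rewrite pds_front//=; apply: pd_eq_in Ux => // y Uy; apply: IH => //.
by rewrite -(perm_cons i) (perm_trans ss')// perm_catC /= perm_cons perm_catC.
Qed.

(* [pdm] differentiates in one fixed order, whereas the recursion for the
   resolvent symbols composes such derivatives. *)
Definition mi_count s : multiindex n := [ffun i => count_mem i s].

Lemma pdm_count s f : smooth_on U f ->
  forall x, U x -> pdm (mi_count s) f x = pds s f x.
Proof.
move=> sf; apply: pds_perm => //.
apply/allP => i _ /=; apply/eqP; rewrite count_flatten -map_comp.
rewrite sumnE big_map big_enum /= (bigD1 i)//= count_nseq /= eqxx mul1n ffunE.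
rewrite big1 ?addn0// => j ji; rewrite count_nseq /= (negbTE ji) mul0n//.
Qed.

Lemma pdm_size (c : multiindex n) :
  size (flatten [seq nseq (c i) i | i <- enum 'I_n]) = mdeg c.
Proof.
rewrite size_flatten /shape -map_comp sumnE big_map big_enum /mdeg /=.
by apply: eq_bigr => i _; rewrite /= size_nseq.
Qed.

(** Chain rule. The formula is proved on the whole open preimage of [U] under the dilation, so that
    it can be differentiated again and also yields differentiability of the left side. *)
Lemma pds_scale s f (lam k : R) : smooth_on U f ->
  forall x, U (lam *: x) ->
  pds s (fun y => k * f (lam *: y)) x = k * lam ^+ size s * pds s f (lam *: x) /\
  differentiable (pds s (fun y => k * f (lam *: y))) x.
Proof.
move=> sf.
have Wo : open [set x | U (lam *: x)].
  by apply: open_comp Uo => y _; exact: scaler_continuous.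
have dE g x : differentiable g (lam *: x) ->
    differentiable (fun y => g (lam *: y)) x.
  by move=> dg; apply: (@differentiable_comp _ _ _ _ ( *:%R lam) g).
have dpd i g c x : differentiable g (lam *: x) ->
    pd i (fun y => c * g (lam *: y)) x = c * lam * pd i g (lam *: x).
  move=> dg; rewrite /pd -[LHS]/('D_ _ (c \*: (fun y => g (lam *: y))) x).
  rewrite deriveZ; last exact/diff_derivable/dE.
  rewrite -mulrA; congr (_ * _).
  by rewrite derive_precomp_scale !(deriveE _ dg) linearZ.
elim: s => [|i s IH] x Ux /=.
  by rewrite mulr1; split => //; apply: differentiableM; last apply: dE (sf [::] _ Ux).
have EW y : U (lam *: y) ->
    pds (i :: s) (fun y => k * f (lam *: y)) y
    = k * lam ^+ (size s).+1 * pds (i :: s) f (lam *: y).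
  move=> Uy /=; rewrite (pd_eq_in Wo i (fun z Uz => (IH z Uz).1) Uy).
  by rewrite dpd ?exprSr ?mulrA//; exact: sf.
split; first exact: EW.
apply: (differentiable_eq_in Wo (fun z Uz => esym (EW z Uz))) => //.
by apply: differentiableM => //; apply: dE; exact: (sf (i :: s)).
Qed.

End Pds.

(** * Convergence of complex and matrix-valued families *)

Section ComplexFamilies.
Variables (R : realType) (n : nat).
Local Notation C := R[i].
Local Notation E := 'rV[R]_n.
Variables (T : Type) (Phi : set_system T).
Context {PF : ProperFilter Phi}.
Variable U : set E.
Hypothesis Uo : open U.
Implicit Types (F G : T -> E -> C).

Definition scvg F q : Prop :=
  smcvg Phi U (fun t x => complex.Re (F t x)) (fun x => complex.Re (q x)) /\
  smcvg Phi U (fun t x => complex.Im (F t x)) (fun x => complex.Im (q x)).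

Lemma scvg_ext F F' q q' :
  (\forall t \near Phi, forall x, U x -> F t x = F' t x) ->
  (forall x, U x -> q x = q' x) -> scvg F q -> scvg F' q'.
Proof.
move=> FF qq [H1 H2]; split => N.
  apply: (ccvg_ext Uo) (H1 N) => [|x Ux]; last by rewrite qq.
  by apply: filterS FF => t FFt x Ux; rewrite FFt.
apply: (ccvg_ext Uo) (H2 N) => [|x Ux]; last by rewrite qq.
by apply: filterS FF => t FFt x Ux; rewrite FFt.
Qed.

Lemma scvg_eq F F' q q' :
  (forall t x, F t x = F' t x) -> (forall x, q x = q' x) ->
  scvg F q -> scvg F' q'.
Proof. by move=> FF qq; apply: scvg_ext => //; apply: nearW => t x _. Qed.

Lemma scvg_cst (k : C) : scvg (fun _ _ => k) (fun=> k).
Proof. by split => N; apply: ccvg_cst. Qed.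

Lemma scvgD F q G h : scvg F q -> scvg G h ->
  scvg (fun t x => F t x + G t x) (fun x => q x + h x).
Proof.
move=> [F1 F2] [G1 G2]; split => N.
  apply: (ccvg_ext Uo) (ccvgD Uo (F1 N) (G1 N)) => [|x Ux].
    by apply: nearW => t x _; rewrite raddfD.
  by rewrite raddfD.
apply: (ccvg_ext Uo) (ccvgD Uo (F2 N) (G2 N)) => [|x Ux].
  by apply: nearW => t x _; rewrite raddfD.
by rewrite raddfD.
Qed.

(** The sign is a factor -1 because the closure lemmas for [ccvg] concern sums, products and
    constants. *)
Let ReM (z w : C) : complex.Re (z * w) =
  complex.Re z * complex.Re w + (-1) * (complex.Im z * complex.Im w).
Proof. by case: z w => [a b] [c d] /=; rewrite mulN1r. Qed.

Let ImM (z w : C) : complex.Im (z * w) =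
  complex.Re z * complex.Im w + complex.Im z * complex.Re w.
Proof. by case: z w => [a b] [c d] /=; rewrite [b * c]mulrC. Qed.

Lemma scvgM F q G h : scvg F q -> scvg G h ->
  scvg (fun t x => F t x * G t x) (fun x => q x * h x).
Proof.
move=> [F1 F2] [G1 G2]; split => N.
  apply: (ccvg_ext Uo) (ccvgD Uo (ccvgM Uo (F1 N) (G1 N))
    (ccvgM Uo (ccvg_cst Uo N (-1)) (ccvgM Uo (F2 N) (G2 N)))) => [|x Ux];
    last by rewrite ReM.
  by apply: nearW => t x _; rewrite ReM.
apply: (ccvg_ext Uo)
  (ccvgD Uo (ccvgM Uo (F1 N) (G2 N)) (ccvgM Uo (F2 N) (G1 N))) => [|x Ux];
  last by rewrite ImM.
by apply: nearW => t x _; rewrite ImM.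
Qed.

Lemma scvgV F q : (\forall t \near Phi, forall x, U x -> F t x != 0) ->
  (forall x, U x -> q x != 0) -> scvg F q ->
  scvg (fun t x => (F t x)^-1) (fun x => (q x)^-1).
Proof.
move=> F0 q0 [F1 F2].
(* The squared modulus, by which 1/z is the conjugate of z divided; it reduces the claim to real
   inverses. *)
pose nm (z : C) := complex.Re z * complex.Re z + complex.Im z * complex.Im z.
have nm0 z : z != 0 -> nm z != 0.
  case: z => a b; apply: contraNneq; rewrite /nm/= -!expr2 => /eqP.
  rewrite paddr_eq0 ?sqr_ge0// !sqrf_eq0 => /andP[/eqP-> /eqP->].
  by [].
have ReV z : complex.Re z^-1 = complex.Re z * (nm z)^-1.
  by case: z.
have ImV z : complex.Im z^-1 = -1 * (complex.Im z * (nm z)^-1).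
  by case: z => a b; rewrite mulN1r.
have HV N : ccvg Phi U N (fun t x => (nm (F t x))^-1) (fun x => (nm (q x))^-1).
  apply: ccvgV => //;
    last exact: (ccvgD Uo (ccvgM Uo (F1 N) (F1 N)) (ccvgM Uo (F2 N) (F2 N))).
    by apply: filterS F0 => t Ft x /Ft /nm0.
  by move=> x /q0 /nm0.
split => N.
  apply: (ccvg_ext Uo) (ccvgM Uo (F1 N) (HV N)) => [|x Ux]; last by rewrite ReV.
  by apply: nearW => t x _; rewrite ReV.
apply: (ccvg_ext Uo) (ccvgM Uo (ccvg_cst Uo N (-1)) (ccvgM Uo (F2 N) (HV N))) => [|x Ux].
  by apply: nearW => t x _; rewrite ImV.
by rewrite ImV.
Qed.

Lemma scvg_sum (I : Type) (r : seq I) (P : pred I) (F : I -> T -> E -> C) q :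
  (forall i, P i -> scvg (F i) (q i)) ->
  scvg (fun t x => \sum_(i <- r | P i) F i t x) (fun x => \sum_(i <- r | P i) q i x).
Proof.
move=> H; elim: r => [|i r IH].
  by apply: scvg_eq (scvg_cst 0) => [t x|x]; rewrite big_nil.
case: (boolP (P i)) => Pi.
  by apply: scvg_eq (scvgD (H i Pi) IH) => [t x|x]; rewrite big_cons Pi.
by apply: scvg_eq IH => [t x|x]; rewrite big_cons (negbTE Pi).
Qed.

Lemma scvg_prod (I : Type) (r : seq I) (P : pred I) (F : I -> T -> E -> C) q :
  (forall i, P i -> scvg (F i) (q i)) ->
  scvg (fun t x => \prod_(i <- r | P i) F i t x) (fun x => \prod_(i <- r | P i) q i x).
Proof.
move=> H; elim: r => [|i r IH].
  by apply: scvg_eq (scvg_cst 1) => [t x|x]; rewrite big_nil.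
case: (boolP (P i)) => Pi.
  by apply: scvg_eq (scvgM (H i Pi) IH) => [t x|x]; rewrite big_cons Pi.
by apply: scvg_eq IH => [t x|x]; rewrite big_cons (negbTE Pi).
Qed.

Lemma scvg_pdmC c F q : scvg F q -> scvg (fun t => pdmC c (F t)) (pdmC c q).
Proof. by move=> [F1 F2]; split; apply: smcvg_pds. Qed.

Lemma scvg_smooth F q : scvg F q -> smoothC_on U q.
Proof. by move=> [F1 F2]; split; apply: smcvg_smooth. Qed.

Lemma smooth_scvg q : smoothC_on U q -> scvg (fun=> q) q.
Proof.
move=> [q1 q2]; split; apply: smcvgP => //.
- by apply: nearW.
- by move=> s x _; apply: cvg_cst.
- by apply: nearW.
- by move=> s x _; apply: cvg_cst.
Qed.

Definition mcvg k l (F : T -> E -> 'M[C]_(k, l)) (q : E -> 'M[C]_(k, l)) :=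
  forall i j, scvg (fun t x => F t x i j) (fun x => q x i j).

Lemma mcvg_ext k l (F F' : T -> E -> 'M[C]_(k, l)) q q' :
  (\forall t \near Phi, forall x, U x -> F t x = F' t x) ->
  (forall x, U x -> q x = q' x) -> mcvg F q -> mcvg F' q'.
Proof.
move=> FF qq H i j; apply: scvg_ext (H i j) => [|x /qq ->//].
by apply: filterS FF => t FFt x Ux; rewrite FFt.
Qed.

Lemma mcvg_cst k l (A : 'M[C]_(k, l)) : mcvg (fun _ _ => A) (fun=> A).
Proof. by move=> i j; exact: scvg_cst. Qed.

Lemma mcvgD k l (F G : T -> E -> 'M[C]_(k, l)) q h : mcvg F q -> mcvg G h ->
  mcvg (fun t x => F t x + G t x) (fun x => q x + h x).
Proof.
by move=> HF HG i j; apply: scvg_eq (scvgD (HF i j) (HG i j)) => [t x|x]; rewrite mxE.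
Qed.

Lemma mcvgM k l p (F : T -> E -> 'M[C]_(k, l)) q (G : T -> E -> 'M[C]_(l, p)) h :
  mcvg F q -> mcvg G h -> mcvg (fun t x => F t x *m G t x) (fun x => q x *m h x).
Proof.
move=> HF HG i j.
apply: scvg_eq (scvg_sum _ (fun k _ => scvgM (HF i k) (HG k j))) => [t x|x];
  by rewrite mxE.
Qed.

Lemma mcvgZ k l F q (G : T -> E -> 'M[C]_(k, l)) h : scvg F q -> mcvg G h ->
  mcvg (fun t x => F t x *: G t x) (fun x => q x *: h x).
Proof.
by move=> HF HG i j; apply: scvg_eq (scvgM HF (HG i j)) => [t x|x]; rewrite mxE.
Qed.

Lemma mcvgN k l (F : T -> E -> 'M[C]_(k, l)) q : mcvg F q ->
  mcvg (fun t x => - F t x) (fun x => - q x).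
Proof.
move=> HF; have := mcvgZ (scvg_cst (-1)) HF; apply: mcvg_ext => [|x _].
  by apply: nearW => t x _; rewrite scaleN1r.
by rewrite scaleN1r.
Qed.

Lemma mcvg_sum (I : Type) (r : seq I) (P : pred I) k l
    (F : I -> T -> E -> 'M[C]_(k, l)) q :
  (forall i, P i -> mcvg (F i) (q i)) ->
  mcvg (fun t x => \sum_(i <- r | P i) F i t x) (fun x => \sum_(i <- r | P i) q i x).
Proof.
move=> H a b; apply: scvg_eq (scvg_sum r (fun i Pi => H i Pi a b)) => [t x|x];
  by rewrite summxE.
Qed.

Lemma scvg_det k (F : T -> E -> 'M[C]_k) q : mcvg F q ->
  scvg (fun t x => \det (F t x)) (fun x => \det (q x)).
Proof.
move=> H; apply: scvg_sum => s _; apply: scvgM; first exact: scvg_cst.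
by apply: scvg_prod => i _; apply: H.
Qed.

Lemma mcvg_adj k (F : T -> E -> 'M[C]_k) q : mcvg F q ->
  mcvg (fun t x => \adj (F t x)) (fun x => \adj (q x)).
Proof.
move=> H i j; apply: scvg_eq (_ : scvg (fun t x => cofactor (F t x) j i)
  (fun x => cofactor (q x) j i)) => [t x|x|]; rewrite ?mxE//.
apply: scvgM; first exact: scvg_cst.
apply: scvg_det => a b.
by apply: scvg_eq (H (lift j a) (lift i b)) => [t x|x]; rewrite !mxE.
Qed.

(** Cramer's rule: the inverse is the adjugate divided by the determinant, and both are polynomials
    in the entries. *)
Lemma mcvg_invmx k (F : T -> E -> 'M[C]_k) q :
  (\forall t \near Phi, forall x, U x -> F t x \in unitmx) ->
  (forall x, U x -> q x \in unitmx) -> mcvg F q ->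
  mcvg (fun t x => invmx (F t x)) (fun x => invmx (q x)).
Proof.
move=> F0 q0 H.
have u0 (A : 'M[C]_k) : A \in unitmx -> \det A != 0 by rewrite unitmxE unitfE.
apply: mcvg_ext (mcvgZ (scvgV _ _ (scvg_det H)) (mcvg_adj H)).
- by apply: filterS F0 => t Ft x Ux; rewrite /invmx Ft.
- by move=> x Ux; rewrite /invmx q0.
- by apply: filterS F0 => t Ft x /Ft /u0.
- by move=> x /q0 /u0.
Qed.

Lemma mcvg_pdmM k l c (F : T -> E -> 'M[C]_(k, l)) q : mcvg F q ->
  mcvg (fun t => pdmM c (F t)) (pdmM c q).
Proof.
by move=> H i j; apply: scvg_eq (scvg_pdmC c (H i j)) => [t x|x]; rewrite mxE.
Qed.

End ComplexFamilies.

(** * Resolvent symbols *)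

Section Linearity.
Variables (R : realType) (n : nat).
Local Notation C := R[i].
Local Notation E := 'rV[R]_n.
Variable U : set E.
Hypothesis Uo : open U.

(** This form covers the real and imaginary parts of a product with a complex constant, which are
    such combinations of Re f and Im f. *)
Lemma pds_lincomb s (a b : R) (f g : E -> R) : smooth_on U f -> smooth_on U g ->
  forall x, U x ->
  pds s (fun y => a * f y + b * g y) x = a * pds s f x + b * pds s g x.
Proof.
move=> sf sg; elim: s => //= i s IH x Ux; rewrite (pd_eq_in Uo i IH Ux).
have df : derivable (pds s f) x (delta_mx 0 i) by apply/diff_derivable/sf.
have dg : derivable (pds s g) x (delta_mx 0 i) by apply/diff_derivable/sg.
have := deriveD (derivableZ (k := a) df) (derivableZ (k := b) dg).
by rewrite (deriveZ a df) (deriveZ b dg).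
Qed.

Lemma pds_cst0 s : pds s (fun _ : E => 0 : R) = fun=> 0.
Proof.
by elim: s => //= i s ->; apply/funext => x; rewrite /pd derive_cst.
Qed.

(** Smoothness is convergence of a constant family; [nbhs (0 : R)] is just some proper filter, here
    and below. *)
Lemma smoothC_cst (k : C) : smoothC_on U (fun=> k).
Proof.
apply: (scvg_smooth (Phi := nbhs (0 : R)) (F := fun _ _ => k)).
by apply: scvg_cst.
Qed.

Lemma smoothC_mul (f g : E -> C) : smoothC_on U f -> smoothC_on U g ->
  smoothC_on U (fun y => f y * g y).
Proof.
move=> sf sg; apply: (scvg_smooth (Phi := nbhs (0 : R)) (F := fun _ y => f y * g y)).
by apply: scvgM => //; exact: smooth_scvg.
Qed.

Lemma smoothC_sum (I : Type) (r : seq I) (P : pred I) (f : I -> E -> C) :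
  (forall i, P i -> smoothC_on U (f i)) ->
  smoothC_on U (fun y => \sum_(i <- r | P i) f i y).
Proof.
move=> sf; apply: (scvg_smooth (Phi := nbhs (0 : R))
  (F := fun _ y => \sum_(i <- r | P i) f i y)).
by apply: scvg_sum => // i Pi; apply: smooth_scvg => //; apply: sf.
Qed.

Lemma pdmC_mulr al (f : E -> C) (k : C) x : smoothC_on U f -> U x ->
  pdmC al (fun y => f y * k) x = pdmC al f x * k.
Proof.
move=> [sf1 sf2] Ux.
have ReE : (fun y => complex.Re (f y * k)) = (fun y =>
    complex.Re k * complex.Re (f y) + - complex.Im k * complex.Im (f y)).
  by apply/funext => y; case: (f y) (k) => [a b] [c d] /=; rewrite mulrC mulNr [b * _]mulrC.
have ImE : (fun y => complex.Im (f y * k)) = (fun y =>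
    complex.Im k * complex.Re (f y) + complex.Re k * complex.Im (f y)).
  by apply/funext => y; case: (f y) (k) => [a b] [c d] /=; rewrite mulrC [b * _]mulrC.
rewrite /pdmC ReE ImE /pdm !pds_lincomb//.
case: k {ReE ImE} => c d /=; apply/eqP; rewrite eq_complex /=.
by rewrite mulNr ![c * _]mulrC ![d * _]mulrC !eqxx.
Qed.

Lemma pdmCD al (f g : E -> C) x : smoothC_on U f -> smoothC_on U g -> U x ->
  pdmC al (fun y => f y + g y) x = pdmC al f x + pdmC al g x.
Proof.
move=> [sf1 sf2] [sg1 sg2] Ux.
have ReE : (fun y => complex.Re (f y + g y)) = (fun y =>
    1 * complex.Re (f y) + 1 * complex.Re (g y)).
  by apply/funext => y; rewrite raddfD !mul1r.
have ImE : (fun y => complex.Im (f y + g y)) = (fun y =>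
    1 * complex.Im (f y) + 1 * complex.Im (g y)).
  by apply/funext => y; rewrite raddfD !mul1r.
by rewrite /pdmC ReE ImE /pdm !pds_lincomb// !mul1r.
Qed.

Lemma pdmC_sum al (I : Type) (r : seq I) (P : pred I) (f : I -> E -> C) x :
  (forall i, P i -> smoothC_on U (f i)) -> U x ->
  pdmC al (fun y => \sum_(i <- r | P i) f i y) x
    = \sum_(i <- r | P i) pdmC al (f i) x.
Proof.
move=> sf Ux; elim: r => [|i r IH].
  rewrite big_nil /pdmC.
  have -> : (fun y => complex.Re (\sum_(i <- [::] | P i) f i y)) = fun=> 0.
    by apply/funext => y; rewrite big_nil.
  have -> : (fun y => complex.Im (\sum_(i <- [::] | P i) f i y)) = fun=> 0.
    by apply/funext => y; rewrite big_nil.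
  by rewrite /pdm !pds_cst0.
rewrite big_cons; case: ifP => Pi.
  have -> : (fun y => \sum_(j <- i :: r | P j) f j y)
      = (fun y => f i y + \sum_(j <- r | P j) f j y).
    by apply/funext => y; rewrite big_cons Pi.
  by rewrite pdmCD ?IH//; [exact: sf | exact: smoothC_sum].
have -> : (fun y => \sum_(j <- i :: r | P j) f j y)
    = (fun y => \sum_(j <- r | P j) f j y).
  by apply/funext => y; rewrite big_cons Pi.
exact: IH.
Qed.

End Linearity.

(** * Symbol components and the recursion for the resolvent *)

Section Symbols.
Variables (R : realType) (n m : nat).
Local Notation C := R[i].
Local Notation E := 'rV[R]_n.
Local Notation EndL := 'M[C]_(ext_dim n).
Local Open Scope complex_scope.
Implicit Types (P L : local_op R n).

(* Common shape of the homogeneous components of the symbol and of their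
   xi-derivatives. *)
Definition coef_sum (phi : multiindex n -> C) P (a : nat) (x : E) : EndL :=
  \sum_(c : {ffun 'I_n -> 'I_m.+1} | (mdeg (mi_of c) + a == m)%N)
    phi (mi_of c) *: P (mi_of c) x.

Definition xi_monomial (c : multiindex n) (xi : E) : C :=
  'i ^+ mdeg c * (\prod_i xi 0 i ^+ c i)%:C.

Lemma symbE P a x xi : symb m P a x xi = coef_sum (xi_monomial^~ xi) P a x.
Proof.
apply: eq_bigr => c _; congr (_ * _%:C *: _).
by apply: eq_bigr => i _; rewrite ffunE.
Qed.

(** The first partial derivatives of a coordinate are constants, so one unfolding leads to
    [ccvg_cst]. *)
Lemma ccvg_coord (T : Type) (Phi : set_system T) {PF : ProperFilter Phi} N i :
  ccvg Phi [set: E] N (fun _ x => x 0 i) (fun x => x 0 i).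
Proof.
have pdE j (x : E) : pd j (fun x : E => x 0 i) x = (delta_mx 0 j : E) 0 i.
  have := derive_mx (@derivable_id _ _ x (delta_mx 0 j)).
  move=> H; transitivity ('D_(delta_mx 0 j : E) (@id E) x 0 i).
    by rewrite H mxE.
  by rewrite derive_id.
case: N => [|N]; split => //.
- by apply: nearW => _ x _; exact: differentiable_coord.
- by move=> x _; exact: differentiable_coord.
- by move=> x _; exact: cvg_cst.
- by apply: nearW => _ x _; exact: differentiable_coord.
- by move=> x _; exact: differentiable_coord.
- by move=> x _; exact: cvg_cst.
move=> j; apply: (ccvg_ext openT) (ccvg_cst openT N ((delta_mx 0 j : E) 0 i)) => [|x _].
  by apply: nearW => _ x _; rewrite pdE.
by rewrite pdE.
Qed.

Lemma smooth_xi_monomial c : smoothC_on [set: E] (xi_monomial c).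
Proof.
have sc i : smoothC_on [set: E] (fun xi => (xi 0 i)%:C).
  split.
    by apply: (smcvg_smooth (Phi := nbhs (0 : R)) (F := fun _ x => x 0 i)) => N;
      exact: ccvg_coord.
  by apply: (smcvg_smooth (Phi := nbhs (0 : R)) (F := fun _ _ => 0)) => N;
    apply: (ccvg_cst openT).
have -> : xi_monomial c
    = fun xi => 'i ^+ mdeg c * \prod_i \prod_(k < c i) (xi 0 i)%:C.
  apply/funext => xi; rewrite /xi_monomial rmorph_prod; congr (_ * _).
  by apply: eq_bigr => i _; rewrite rmorphXn prodr_const card_ord.
apply: (smoothC_mul openT); first exact: (smoothC_cst openT).
apply: (scvg_smooth (Phi := nbhs (0 : R))
  (F := fun _ (xi : E) => \prod_i \prod_(k < c i) (xi 0 i)%:C)).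
apply: (scvg_prod openT) => i _; apply: (scvg_prod openT) => k _.
exact: smooth_scvg.
Qed.

(** The xi-derivatives fall only on the monomials in i xi, so the result is again a [coef_sum], for
    which both the limit and the rescaling rule are available. *)
Lemma pdmM_symb al P a x xi :
  pdmM al (symb m P a x) xi = coef_sum (fun c => pdmC al (xi_monomial c) xi) P a x.
Proof.
apply/matrixP => I J; rewrite mxE summxE.
have -> : (fun y => symb m P a x y I J) = (fun y =>
    \sum_(c : {ffun 'I_n -> 'I_m.+1} | (mdeg (mi_of c) + a == m)%N)
      xi_monomial (mi_of c) y * P (mi_of c) x I J).
  by apply/funext => y; rewrite symbE summxE; apply: eq_bigr => c _; rewrite mxE.
rewrite (pdmC_sum openT)//; last first.
  move=> c _; apply: (smoothC_mul openT); first exact: smooth_xi_monomial.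
  exact: (smoothC_cst openT).
apply: eq_bigr => c _; rewrite (pdmC_mulr openT)// ?mxE//.
exact: smooth_xi_monomial.
Qed.

(** Deepening the table leaves its earlier components unchanged, which allows the recursion to be
    restated for [res_symb] alone. *)
Lemma res_table_symb P mu j b : (b <= j)%N ->
  res_table m P mu j b = res_symb m P mu b.
Proof.
elim: j => [|j IH] in b *; first by rewrite leqn0 => /eqP ->.
rewrite leq_eqVlt => /predU1P[->//|]; rewrite ltnS => bj.
by rewrite /= bj IH.
Qed.

Lemma res_symbS P mu j x xi :
  res_symb m P mu j.+1 x xi = - (res_symb m P mu 0 x xi *m
    \sum_(a < j.+2) \sum_(b < j.+1)
    \sum_(al : {ffun 'I_n -> 'I_j.+2} | (a + b + mdeg (mi_of al) == j.+1)%N)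
      ((- 'i) ^+ mdeg (mi_of al) / (\prod_i (al i)`!)%N%:R) *:
        (pdmM (mi_of al) (symb m P a x) xi
         *m pdmM (mi_of al) (fun y => res_symb m P mu b y xi) x)).
Proof.
rewrite {1}/res_symb [res_table _ _ _ j.+1 j.+1]/=.
rewrite ltnn (res_table_symb P mu (leq0n j)); congr (- (_ *m _)).
apply: eq_bigr => a _; apply: eq_bigr => b _; apply: eq_bigr => al _.
by rewrite res_table_symb // -ltnS.
Qed.

Section Convergence.
Variables (T : Type) (Phi : set_system T).
Context {PF : ProperFilter Phi}.
Variable U : set E.
Hypothesis Uo : open U.
Variables (A : T -> local_op R n) (L : local_op R n).
Hypothesis AL : forall c, (mdeg c <= m)%N -> mcvg Phi U (fun t => A t c) (L c).

Lemma mcvg_coef_sum phi a :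
  mcvg Phi U (fun t x => coef_sum phi (A t) a x) (coef_sum phi L a).
Proof.
apply: mcvg_sum => // c cm; apply: mcvgZ => //; first exact: scvg_cst.
by apply: AL; rewrite (leq_trans (leq_addr a _))// (eqP cm).
Qed.

Variables (mu : C) (xi : E).
Hypothesis Areg : \forall t \near Phi, forall x, U x ->
  symb m (A t) 0 x xi - mu%:M \in unitmx.
Hypothesis Lreg : forall x, U x -> symb m L 0 x xi - mu%:M \in unitmx.

(** At fixed mu and xi, only the component of index 0 involves an inverse; the others arise from it
    and from the coefficients by sums, products and derivatives. *)
Lemma mcvg_res_symb j : mcvg Phi U
  (fun t x => res_symb m (A t) mu j x xi) (fun x => res_symb m L mu j x xi).
Proof.
have H0 : mcvg Phi U
    (fun t x => res_symb m (A t) mu 0 x xi) (fun x => res_symb m L mu 0 x xi).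
  apply: (mcvg_invmx Uo) => //; apply: (mcvgD Uo); last exact: (mcvg_cst Uo).
  apply: (mcvg_ext Uo) (mcvg_coef_sum (xi_monomial^~ xi) 0) => [|x _].
    by apply: nearW => t x _; rewrite symbE.
  by rewrite symbE.
elim/ltn_ind: j => -[//|j] IH.
(* The right side of the recursion with the xi-derivatives already carried out, so that only
   x-derivatives of convergent families remain. *)
pose rhs (B : local_op R n) x := - (res_symb m B mu 0 x xi *m
    \sum_(a < j.+2) \sum_(b < j.+1)
    \sum_(al : {ffun 'I_n -> 'I_j.+2} | (a + b + mdeg (mi_of al) == j.+1)%N)
      ((- 'i) ^+ mdeg (mi_of al) / (\prod_i (al i)`!)%N%:R) *:
        (coef_sum (fun c => pdmC (mi_of al) (xi_monomial c) xi) B a x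
         *m pdmM (mi_of al) (fun y => res_symb m B mu b y xi) x)).
have rhsE B x : rhs B x = res_symb m B mu j.+1 x xi.
  rewrite res_symbS; congr (- (_ *m _)).
  apply: eq_bigr => a _; apply: eq_bigr => b _; apply: eq_bigr => al _.
  by rewrite pdmM_symb.
have : mcvg Phi U (fun t => rhs (A t)) (rhs L).
  apply: (mcvgN Uo); apply: (mcvgM Uo) => //.
  apply: (mcvg_sum Uo) => a _; apply: (mcvg_sum Uo) => b _.
  apply: (mcvg_sum Uo) => al _; apply: (mcvgZ Uo); first exact: (scvg_cst Uo).
  apply: (mcvgM Uo); last exact: (mcvg_pdmM Uo (mi_of al) (IH b (ltn_ord b))).
  exact: mcvg_coef_sum.
by apply: (mcvg_ext Uo) => [|x _]; [apply: nearW => t x _|]; rewrite rhsE.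
Qed.

End Convergence.

End Symbols.

(** * Rescaling *)

Section Conjugation.
Variables (R : realType) (n : nat).
Local Notation C := R[i].
Local Notation E := 'rV[R]_n.
Local Notation EndL := 'M[C]_(ext_dim n).
Local Open Scope complex_scope.
Variable lam : R.
Hypothesis lam0 : lam != 0.
Implicit Types A B : EndL.

Definition U_conj A : EndL := U_mx n lam *m A *m invmx (U_mx n lam).

Let V_mx : EndL :=
  diag_mx (\row_k (lam ^+ #|(enum_val k : {set 'I_n})|)%:C).

Let U_mxK : U_mx n lam *m V_mx = 1%:M.
Proof.
rewrite /U_mx /V_mx mulmx_diag -diag_const_mx; congr diag_mx.
apply/rowP => k; rewrite !mxE -rmorphM /= mulVf ?rmorph1//.
by rewrite expf_neq0.
Qed.

Lemma U_mx_unit : U_mx n lam \in unitmx.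
Proof. by case/mulmx1_unit: U_mxK. Qed.

Let invU : invmx (U_mx n lam) = V_mx.
Proof. by rewrite -[RHS](mulKmx U_mx_unit) U_mxK mulmx1. Qed.

(** Both [U_mx] and its inverse are diagonal. From degree 0 to degree n the factor is lam^-n. *)
Lemma U_conjE A i j : U_conj A i j =
  (lam ^- #|(enum_val i : {set 'I_n})| * lam ^+ #|(enum_val j : {set 'I_n})|)%:C
  * A i j.
Proof.
by rewrite /U_conj invU /U_mx /V_mx mul_diag_mx mul_mx_diag !mxE rmorphM mulrAC.
Qed.

Lemma U_conjM A B : U_conj (A *m B) = U_conj A *m U_conj B.
Proof. by rewrite /U_conj !mulmxA (mulmxKV U_mx_unit). Qed.

Lemma U_conjZ (k : C) A : U_conj (k *: A) = k *: U_conj A.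
Proof. by rewrite /U_conj -scalemxAr -scalemxAl. Qed.

Lemma U_conjN A : U_conj (- A) = - U_conj A.
Proof. by rewrite -scaleN1r U_conjZ scaleN1r. Qed.

Lemma U_conjD A B : U_conj (A + B) = U_conj A + U_conj B.
Proof. by rewrite /U_conj mulmxDr mulmxDl. Qed.

Lemma U_conj_sum (I : Type) (r : seq I) (P : pred I) (F : I -> EndL) :
  U_conj (\sum_(i <- r | P i) F i) = \sum_(i <- r | P i) U_conj (F i).
Proof. by rewrite /U_conj mulmx_sumr mulmx_suml. Qed.

Lemma U_conj_scalar (k : C) : U_conj k%:M = k%:M.
Proof. by rewrite /U_conj mul_mx_scalar -scalemxAl (mulmxV U_mx_unit) scalemx1. Qed.

Lemma det_U_conj A : \det (U_conj A) = \det A.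
Proof.
by rewrite /U_conj !det_mulmx det_inv mulrAC mulfV ?mul1r// -unitfE -unitmxE U_mx_unit.
Qed.

Lemma U_conjV A : A \in unitmx -> invmx (U_conj A) = U_conj (invmx A).
Proof.
move=> Au; have E1 : U_conj A *m U_conj (invmx A) = 1%:M.
  by rewrite -U_conjM mulmxV// U_conj_scalar.
have [Bu _] := mulmx1_unit E1.
by rewrite -[RHS](mulKmx Bu) E1 mulmx1.
Qed.

(** Conjugation multiplies each entry by a real constant [w], so [pds_scale] applies to both parts
    of the entry and every derivative contributes one factor lam. *)
Lemma pdmM_U_conj (V : set E) (Vo : open V) al (k : R) (G : E -> EndL) x :
  (forall i j, smoothC_on V (fun y => G y i j)) -> V (lam *: x) ->
  pdmM al (fun y => k%:C *: U_conj (G (lam *: y))) x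
    = (k * lam ^+ mdeg al)%:C *: U_conj (pdmM al G (lam *: x)).
Proof.
move=> sG Vx; apply/matrixP => i j; rewrite [LHS]mxE [RHS]mxE U_conjE mxE.
set w := lam ^- _ * _; have [sG1 sG2] := sG i j.
have ReE : (fun y => complex.Re ((k%:C *: U_conj (G (lam *: y))) i j))
    = (fun y => (k * w) * complex.Re (G (lam *: y) i j)).
  apply/funext => y; rewrite mxE U_conjE -/w mulrA -rmorphM.
  by case: (G _ _ _) => p q /=; rewrite mul0r subr0.
have ImE : (fun y => complex.Im ((k%:C *: U_conj (G (lam *: y))) i j))
    = (fun y => (k * w) * complex.Im (G (lam *: y) i j)).
  apply/funext => y; rewrite mxE U_conjE -/w mulrA -rmorphM.
  by case: (G _ _ _) => p q /=; rewrite mul0r addr0.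
rewrite /pdmC ReE ImE /pdm.
have [-> _] := pds_scale Vo (flatten [seq nseq (al i) i | i <- enum 'I_n])
  (k * w) sG1 Vx.
have [-> _] := pds_scale Vo (flatten [seq nseq (al i) i | i <- enum 'I_n])
  (k * w) sG2 Vx.
rewrite pdm_size mulrA -rmorphM; apply/eqP; rewrite eq_complex /=.
by rewrite !mul0r subr0 addr0 [k * w * _]mulrAC !eqxx.
Qed.

End Conjugation.

Section RescaledSymbols.
Variables (R : realType) (n m : nat).
Local Notation C := R[i].
Local Notation E := 'rV[R]_n.
Local Notation EndL := 'M[C]_(ext_dim n).
Local Open Scope complex_scope.
Variable lam : R.
Hypothesis lam0 : lam != 0.
Variable P : local_op R n.
Let Q := rescaled m lam P.

(** The powers lam^m and lam^-|c| combine to lam^a, as |c| + a = m in the sum. *)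
Lemma coef_sum_rescaled phi a x : coef_sum m phi Q a x
  = (lam ^+ a)%:C *: U_conj lam (coef_sum m phi P a (lam *: x)).
Proof.
rewrite /coef_sum U_conj_sum scaler_sumr; apply: eq_bigr => c /eqP cm.
rewrite /Q /rescaled /f_sharp /U_sharp U_conjZ -/(U_conj _ _) !scalerA.
congr (_ *: _); rewrite [RHS]mulrC -mulrA -rmorphM; congr (_ * _%:C).
by rewrite -{1}cm exprD mulrAC divff ?mul1r// expf_neq0.
Qed.

Lemma pdmM_eq_in (W : set E) k l al (F G : E -> 'M[C]_(k, l)) x : open W ->
  (forall y, W y -> F y = G y) -> W x -> pdmM al F x = pdmM al G x.
Proof.
move=> Wo FG Wx; apply/matrixP => i j; rewrite !mxE /pdmC /pdm.
by congr (_ +i* _); apply: (pds_eq_in Wo) => // y Wy; rewrite FG.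
Qed.

Lemma symb_rescaled a x xi :
  symb m Q a x xi = (lam ^+ a)%:C *: U_conj lam (symb m P a (lam *: x) xi).
Proof. by rewrite !symbE coef_sum_rescaled. Qed.

(** The leading symbol carries the power lam^0 and scalar matrices are fixed by conjugation; hence
    mu is not rescaled. *)
Lemma symb0_rescaled (mu : C) x xi : symb m Q 0 x xi - mu%:M
  = U_conj lam (symb m P 0 (lam *: x) xi - mu%:M).
Proof.
by rewrite symb_rescaled expr0 scale1r U_conjD U_conjN U_conj_scalar.
Qed.

Let scale_mulmx_eq (h a b c : C) (S T A B : EndL) :
  S = a *: A -> T = b *: B -> a * b = c -> h *: (S *m T) = c *: (h *: (A *m B)).
Proof.
move=> -> -> <-; rewrite -scalemxAl -scalemxAr !scalerA.
by congr (_ *: _); rewrite -mulrA mulrC.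
Qed.

(** In each term of the recursion the symbol gives lam^a, the earlier component lam^b and its
    x-derivatives lam^|al|, where a + b + |al| = j + 1. Conjugation is multiplicative. *)
Lemma res_symb_rescaled (V : set E) (Vo : open V) (mu : C) xi :
  (forall y, V y -> symb m P 0 y xi - mu%:M \in unitmx) ->
  (forall j I J, smoothC_on V (fun y => res_symb m P mu j y xi I J)) ->
  forall j x, V (lam *: x) -> res_symb m Q mu j x xi
    = (lam ^+ j)%:C *: U_conj lam (res_symb m P mu j (lam *: x) xi).
Proof.
move=> Preg Psm.
have Wo : open [set y : E | V (lam *: y)].
  by apply: open_comp Vo => y _; exact: scaler_continuous.
elim/ltn_ind => -[|j] IH x Vx.
  by rewrite expr0 scale1r -U_conjV ?Preg// -symb0_rescaled.
rewrite !res_symbS U_conjN (U_conjM lam0).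
have scaleN (k : C) (A : EndL) : k *: - A = - (k *: A) by rewrite scalerN.
rewrite scaleN scalemxAr.
rewrite (IH 0%N)// expr0 scale1r; congr (- (_ *m _)).
rewrite !U_conj_sum scaler_sumr; apply: eq_bigr => a _.
rewrite !U_conj_sum scaler_sumr; apply: eq_bigr => b _.
rewrite !U_conj_sum scaler_sumr; apply: eq_bigr => al /eqP alE.
rewrite U_conjZ (U_conjM lam0).
have Esym : pdmM (mi_of al) (symb m Q a x) xi
    = (lam ^+ a)%:C *: U_conj lam (pdmM (mi_of al) (symb m P a (lam *: x)) xi).
  by rewrite !pdmM_symb coef_sum_rescaled.
have Eres : pdmM (mi_of al) (fun y => res_symb m Q mu b y xi) x
    = (lam ^+ b * lam ^+ mdeg (mi_of al))%:C *:
      U_conj lam (pdmM (mi_of al) (fun y => res_symb m P mu b y xi) (lam *: x)).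
  rewrite -(pdmM_U_conj lam0 Vo _ _ (Psm b) Vx).
  (* The induction hypothesis holds on an open set around x, hence may be differentiated. *)
  by apply: (pdmM_eq_in _ Wo) => // y Wy; exact: IH.
have kE : (lam ^+ a)%:C * (lam ^+ b * lam ^+ mdeg (mi_of al))%:C = (lam ^+ j.+1)%:C.
  by rewrite -rmorphM mulrA -!exprD alE.
exact: scale_mulmx_eq Esym Eres kE.
Qed.

End RescaledSymbols.

(** * The limit of the rescaled symbols *)

Section EuclideanNorm.
Variables (R : realType) (n : nat).
Implicit Types x : 'rV[R]_n.

Lemma enormZ (k : R) x : enorm (k *: x) = `|k| * enorm x.
Proof.
rewrite /enorm; under eq_bigr => i _ do rewrite mxE exprMn.
by rewrite -mulr_sumr sqrtrM ?sqr_ge0// sqrtr_sqr.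
Qed.

Lemma enorm0 : enorm (0 : 'rV[R]_n) = 0.
Proof. by rewrite -(scale0r 0) enormZ normr0 mul0r. Qed.

(** The balls of the topology are those of the maximum norm, whereas the coordinate domain is a
    Euclidean ball; this compares them. *)
Lemma norm_le_enorm x : `|x| <= enorm x.
Proof.
rewrite -[`|x|]/(mx_norm x) mx_normrE; apply/bigmax_leP.
split=> [|[i j] _ /=]; first exact: sqrtr_ge0.
rewrite ord1 -sqrtr_sqr ler_wsqrtr// (bigD1 j)//= lerDl.
by apply: sumr_ge0 => k _; exact: sqr_ge0.
Qed.

End EuclideanNorm.

(** Multiplication by i preserves the modulus and turns the imaginary part, up to sign, into the
    real part. *)
Lemma normc_ge_Im (R : rcfType) (z : R[i]) : (`|complex.Im z|%:C <= `|z|)%C.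
Proof.
have i1 : `|'i%C| = 1 :> R[i] by rewrite normc_def /= expr0n expr1n add0r sqrtr1.
have -> : `|z| = `|z * 'i%C| by rewrite normrM i1 mulr1.
by apply: le_trans (normc_ge_Re _); rewrite ReiNIm normrN.
Qed.

Section RescalingLimit.
Variables (R : realType) (n m : nat) (r : R).
Local Notation C := R[i].
Local Notation E := 'rV[R]_n.
Local Open Scope complex_scope.
Local Notation U := (@eball R n r).
Hypotheses (r0 : 0 < r) (Uo : open U).
Variables P L : local_op R n.
Hypothesis sP : smooth_coefs m U P.
Hypothesis PL : rescaling_limit m U P L.

Lemma eball_scale (k : R) x : 0 <= k <= 1 -> U x -> U (k *: x).
Proof.
rewrite /eball /= enormZ => /andP[k0 k1] xr; rewrite ger0_norm//.
by apply: le_lt_trans xr; rewrite ler_piMl// sqrtr_ge0.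
Qed.

Lemma eball_0 : U 0.
Proof. by rewrite /eball /= enorm0. Qed.

Lemma near_right0 : \forall lam \near 0^'+, 0 < lam <= (1 : R).
Proof.
near=> lam; apply/andP; split; last apply/ltW; near: lam.
  exact: nbhs_right_gt.
exact: nbhs_right_lt.
Unshelve. all: by end_near. Qed.

Lemma mcvg_rescaled c : (mdeg c <= m)%N ->
  mcvg 0^'+ U (fun lam => rescaled m lam P c) (L c).
Proof.
case: PL => sL cL cm I J.
have [sL1 sL2] := sL c cm I J; have [sP1 sP2] := sP cm I J.
have entryE lam y : lam != 0 -> rescaled m lam P c y I J
    = (lam ^+ m * (lam ^- mdeg c * (lam ^- #|(enum_val I : {set 'I_n})|
        * lam ^+ #|(enum_val J : {set 'I_n})|)))%:C * P c (lam *: y) I J.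
  move=> lam0; rewrite /rescaled /f_sharp /U_sharp -/(U_conj _ _) mxE.
  by rewrite mxE (U_conjE lam0) !rmorphM !mulrA.
(* [part] stands for the real or the imaginary part. For 0 < lam <= 1 the dilation maps the ball
   into itself, so the rescaled coefficients are smooth on it. *)
have smooth_near (part : C -> R) :
    (forall (k : R) z, part (k%:C * z) = k * part z) ->
    smooth_on U (fun y => part (P c y I J)) ->
    \forall lam \near 0^'+,
      smooth_on U (fun x => part (rescaled m lam P c x I J)).
  move=> partZ sPp; apply: filterS near_right0 => lam /andP[lam0 lam1].
  have lamN0 : lam != 0 by rewrite gt_eqF.
  rewrite /smooth_on.
  under [X in forall s x, _ -> differentiable (pds s X) x]eq_fun => x do
    rewrite (entryE _ _ lamN0) partZ.
  by move=> s x Ux; apply: (pds_scale Uo s _ sPp (eball_scale _ Ux)).2;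
    rewrite ltW.
have cvg_part (part : C -> R) :
    (forall z, (`|part z|%:C <= `|z|)) ->
    (forall (f : E -> C) x al, part (pdmC al f x) = pdm al (fun y => part (f y)) x) ->
    (forall z w, part (z - w) = part z - part w) ->
    smooth_on U (fun y => part (L c y I J)) ->
    (\forall lam \near 0^'+,
      smooth_on U (fun x => part (rescaled m lam P c x I J))) ->
    smcvg 0^'+ U (fun lam x => part (rescaled m lam P c x I J))
      (fun x => part (L c x I J)).
  move=> part_le partE partB sLp sPp; apply: smcvgP => // s x Ux.
  apply/cvgrPdist_lt => e e0.
  (* Pointwise convergence comes from the compact set {x}; the list [s] is traded for the
     multi-index that counts its entries. *)
  have [_ /(_ (mi_count s) cm [set x] (@compact_set1 _ x))] := (sL, cL c).
  have sxU : [set x] `<=` U by move=> _ ->.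
  move=> /(_ sxU I J e e0); apply: filterS2 sPp => lam sPl /(_ x erefl) H.
  rewrite -(pdm_count Uo s sLp Ux) -(pdm_count Uo s sPl Ux) -!partE -partB.
  by rewrite -ltcR; apply: le_lt_trans (part_le _) _; rewrite distrC.
split.
  apply: cvg_part => //.
  - exact: normc_ge_Re.
  - by move=> z w; rewrite raddfB.
  - by apply: smooth_near => // k [a b] /=; rewrite mul0r subr0.
apply: cvg_part => //.
- exact: normc_ge_Im.
- by move=> z w; rewrite raddfB.
- by apply: smooth_near => // k [a b] /=; rewrite mul0r addr0.
Qed.

(** F lam x tends to q x by convergence, and h (lam x) tends to h 0 by continuity. This is how a
    value at an arbitrary x is identified with one at p. *)
Lemma eq_at_center (V : set E) (F : R -> E -> C) (q h : E -> C) x :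
  open V -> V 0 -> U x -> smoothC_on V h -> scvg 0^'+ U F q ->
  (\forall lam \near 0^'+, F lam x = h (lam *: x)) -> q x = h 0.
Proof.
move=> Vo V0 Ux [h1 h2] [F1 F2] Fh.
have lx0 : lam *: x @[lam --> 0^'+] --> (0 : E).
  apply: cvg_at_right_filter; rewrite -[X in _ --> X](scale0r x).
  exact: scalel_continuous.
have cont (f : E -> R) : smooth_on V f ->
    f (lam *: x) @[lam --> 0^'+] --> f 0.
  move=> sf; have cf : {for 0, continuous f}.
    by apply: differentiable_continuous; exact: (sf [::]).
  exact: (cvg_comp (fun lam => lam *: x) f lx0 cf).
have lim_eq (part : C -> R) :
    (fun lam => part (F lam x)) @ 0^'+ --> part (q x) ->
    part (h (lam *: x)) @[lam --> 0^'+] --> part (h 0) ->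
    part (q x) = part (h 0).
  move=> c1 c2; apply: (cvg_unique _ c1) => //; apply: cvg_trans c2.
  by apply: near_eq_cvg; apply: filterS Fh => lam ->.
apply/eqP; rewrite eq_complex; apply/andP; split; apply/eqP.
  exact: (lim_eq (@complex.Re R) (ccvg_cvg (F1 0%N) Ux) (cont _ h1)).
exact: (lim_eq (@complex.Im R) (ccvg_cvg (F2 0%N) Ux) (cont _ h2)).
Qed.

(** Stated for any family, to serve both the rescaled operators and the constant family [P]. *)
Lemma mcvg_symb0 (T : Type) (Phi : set_system T) {PF : ProperFilter Phi}
    (A : T -> local_op R n) B (mu : C) xi :
  (forall c, (mdeg c <= m)%N -> mcvg Phi U (fun t => A t c) (B c)) ->
  mcvg Phi U (fun t x => symb m (A t) 0 x xi - mu%:M)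
    (fun x => symb m B 0 x xi - mu%:M).
Proof.
move=> AB; apply: (mcvgD Uo); last exact: (mcvg_cst Uo).
apply: (mcvg_ext Uo) (mcvg_coef_sum Uo AB (fun c => xi_monomial c xi) 0) => [|x _].
  by apply: nearW => t x _; rewrite symbE.
by rewrite symbE.
Qed.

Lemma smooth_scvg_coefs c : (mdeg c <= m)%N -> mcvg (nbhs (0 : R)) U (fun=> P c) (P c).
Proof. by move=> cm I J; apply: smooth_scvg; exact: sP. Qed.

Lemma smooth_det (mu : C) xi :
  smoothC_on U (fun y => \det (symb m P 0 y xi - mu%:M)).
Proof.
exact: (scvg_smooth (scvg_det Uo (mcvg_symb0 mu xi smooth_scvg_coefs))).
Qed.

(** Determinants are invariant under conjugation, so the rescaled determinant at x is that of [P] at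
    lam x, and [eq_at_center] applies. As mu varies, the characteristic polynomials agree. *)
Lemma det_symb0_limit (mu : C) xi x : U x ->
  \det (symb m L 0 x xi - mu%:M) = \det (symb m P 0 0 xi - mu%:M).
Proof.
move=> Ux.
apply: (eq_at_center (q := fun x => \det (symb m L 0 x xi - mu%:M))
  (F := fun lam x => \det (symb m (rescaled m lam P) 0 x xi - mu%:M))
  Uo eball_0 Ux (smooth_det mu xi)).
  exact: (scvg_det Uo (mcvg_symb0 mu xi mcvg_rescaled)).
apply: filterS near_right0 => lam /andP[lam0 _].
by rewrite symb0_rescaled ?gt_eqF// det_U_conj ?gt_eqF.
Qed.

(** The determinant is continuous, and a complex number is non-zero as soon as one of its two parts
    is. *)
Lemma regular_near0 (mu : C) xi : symb m P 0 0 xi - mu%:M \in unitmx ->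
  exists2 e : R, 0 < e &
    forall y, ball 0 e y -> U y /\ symb m P 0 y xi - mu%:M \in unitmx.
Proof.
move=> u0; have det0 : \det (symb m P 0 0 xi - mu%:M) != 0 by rewrite -unitfE -unitmxE.
have near_ne (f : E -> R) : smooth_on U f -> f 0 != 0 -> \forall y \near (0 : E), f y != 0.
  move=> sf f0; have cf : {for 0, continuous f}.
    by apply: differentiable_continuous; exact: (sf [::] 0 eball_0).
  have nz : nbhs (f 0) [set z : R | z != 0].
    by apply: open_nbhs_nbhs; split => //; exact: open_neq.
  exact: (cf _ nz).
have near_neC (h : E -> C) : smoothC_on U h -> h 0 != 0 ->
    \forall y \near (0 : E), h y != 0.
  move=> [h1 h2]; rewrite eq_complex negb_and => /orP[h0|h0].
    by apply: filterS (near_ne _ h1 h0) => y; apply: contra_neq => ->.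
  by apply: filterS (near_ne _ h2 h0) => y; apply: contra_neq => ->.
have /nbhs_ballP[e e0 He] : \forall y \near (0 : E),
    U y /\ \det (symb m P 0 y xi - mu%:M) != 0.
  by apply: filterI (near_open Uo eball_0) (near_neC _ (smooth_det mu xi) det0).
by exists e => // y /He[? ?]; rewrite unitmxE unitfE.
Qed.

(** On a small ball about 0 the resolvent symbols of [P] are smooth. For small lam the dilation
    brings all of [U] into that ball, so the rescaled symbols are regular on [U] and converge;
    [eq_at_center] then compares the entry at x with that of [P] at 0. *)
Lemma res_symb_limit (mu : C) xi x : U x ->
  symb m P 0 0 xi - mu%:M \in unitmx ->
  res_symb m P mu n 0 xi (ix finset.setT) (ix finset.set0)
  = res_symb m L mu n x xi (ix finset.setT) (ix finset.set0).
Proof.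
move=> Ux u0; have [e e0 He] := regular_near0 u0.
have Preg y : ball 0 e y -> symb m P 0 y xi - mu%:M \in unitmx by case/He.
have Psm j I J : smoothC_on (ball 0 e) (fun y => res_symb m P mu j y xi I J).
  have HP c : (mdeg c <= m)%N ->
      mcvg (nbhs (0 : R)) (ball (0 : E) e) (fun=> P c) (P c).
    move=> cm a b; apply: smooth_scvg.
    have [s1 s2] := sP cm a b.
    by split => s y /He[Uy _]; [exact: s1 | exact: s2].
  apply: (scvg_smooth (mcvg_res_symb (ball_open _ _) HP _ _ j I J)) => //.
  exact: nearW.
have near_ball : \forall lam \near 0^'+,
    lam != 0 /\ forall y, U y -> ball (0 : E) e (lam *: y).
  near=> lam.
  have lam0 : 0 < lam by near: lam; exact: nbhs_right_gt.
  split=> [|y Uy]; first by rewrite gt_eqF.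
  rewrite -ball_normE /= sub0r normrN normrZ gtr0_norm//.
  rewrite (le_lt_trans (ler_wpM2l (ltW lam0) (norm_le_enorm y)))//.
  (* Points of [U] have norm below r, so lam < e / r is enough. *)
  rewrite (lt_trans (y := lam * r)) ?ltr_pM2l// -ltr_pdivlMr//.
  by near: lam; apply: nbhs_right_lt; rewrite divr_gt0.
apply/esym; set T := ix finset.setT; set O := ix finset.set0.
apply: (eq_at_center (q := fun x => res_symb m L mu n x xi T O)
  (F := fun lam x => res_symb m (rescaled m lam P) mu n x xi T O)
  (ball_open _ _) (ballxx 0 e0) Ux (Psm n T O)).
  apply: (mcvg_res_symb Uo mcvg_rescaled).
    apply: filterS near_ball => lam [lam0 Hlam] y Uy.
    rewrite unitmxE (symb0_rescaled m lam0) (det_U_conj lam0) -unitmxE.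
    exact: Preg _ (Hlam y Uy).
  by move=> y Uy; rewrite unitmxE det_symb0_limit// -unitmxE.
apply: filterS near_ball => lam [lam0 Hlam].
rewrite (res_symb_rescaled lam0 (ball_open _ _) Preg Psm)//; last exact: Hlam.
(* From degree 0 to degree n, conjugation gives lam^-n, which cancels the lam^n of the component of
   index n. *)
rewrite mxE (U_conjE lam0) /T /O /ix !enum_rankK cardsT card_ord cards0 expr0 mulr1.
by rewrite mulrA -rmorphM mulfV ?rmorph1 ?mul1r// expf_neq0.
Unshelve. all: by end_near. Qed.

End RescalingLimit.

(** * Contour integrals and the residue density *)

Section Contour.
Variables (R : realType) (n m : nat).
Local Notation C := R[i].
Local Notation E := 'rV[R]_n.
Local Open Scope complex_scope.

Lemma eigenvalue_unitmx (k : nat) (A : 'M[C]_k) (mu : C) :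
  eigenvalue A mu = (A - mu%:M \notin unitmx).
Proof. by rewrite /eigenvalue /eigenspace unfold_in kermx_eq0 row_free_unit. Qed.

Lemma norm_polar (rho t : R) : 0 <= rho -> `|polar rho t| = rho%:C.
Proof.
move=> rho0; rewrite normc_def /= !exprMn -mulrDr cos2Dsin2 mulr1.
by rewrite sqrtr_sqr ger0_norm.
Qed.

Lemma polar_2pi (rho t : R) : polar rho (t - 2 * pi) = polar rho t.
Proof.
have pi2 : 2 * pi = pi *+ 2 :> R by rewrite mulr_natl.
rewrite /polar -[in RHS](subrK (2 * pi) t); congr (_ * _ +i* (_ * _)); rewrite pi2.
  by rewrite cosD2pi.
by rewrite sinD2pi.
Qed.

Lemma eq_Cintegral (D : set R) (f g : R -> C) :
  (forall t, D t -> f t = g t) -> Cintegral D f = Cintegral D g.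
Proof.
move=> fg; rewrite /Cintegral; congr (_ +i* _);
  by apply: eq_Rintegral => t /set_mem /fg ->.
Qed.

(** The incoming and outgoing rays consist of the same points and differ only in the branch of the
    power, so one condition covers both. *)
Lemma eq_contour_integral (th rho : R) (z : C) (f g : C -> C) :
  (forall s, rho <= s -> f (polar s th) = g (polar s th)) ->
  (forall t, f (polar rho t) = g (polar rho t)) ->
  contour_integral th rho z f = contour_integral th rho z g.
Proof.
move=> fg_ray fg_circle; rewrite /contour_integral.
congr (- _ - _ + _); apply: eq_Cintegral => t /=; rewrite in_itv /=.
- by rewrite andbT => /fg_ray ->.
- by rewrite fg_circle.
- by rewrite andbT polar_2pi => /fg_ray ->.
Qed.

(** Equal spectra admit the same small radii, and the contour avoids the spectrum, so the integrands
    agree along it. The two sets of admissible values then coincide, and [xget] selects the same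
    element. *)
Lemma eq_log_entry (P L : local_op R n) (th : R) j (x y xi : E) I J :
  (forall mu, eigenvalue (symb m L 0 y xi) mu = eigenvalue (symb m P 0 x xi) mu) ->
  (forall s, 0 <= s -> ~~ eigenvalue (symb m P 0 x xi) (polar s th)) ->
  (forall mu, ~~ eigenvalue (symb m P 0 x xi) mu ->
     res_symb m P mu j x xi I J = res_symb m L mu j y xi I J) ->
  log_entry m P th j x xi I J = log_entry m L th j y xi I J.
Proof.
move=> eigE ray resE; rewrite /log_entry.
have radE rho : small_radius m P x xi rho <-> small_radius m L y xi rho.
  split=> -[rho0 H]; apply: (conj rho0) => mu eig.
    exact: (H _ (etrans (esym (eigE mu)) eig)).
  exact: (H _ (etrans (eigE mu) eig)).
have powE rho z : small_radius m P x xi rho ->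
    power_symb m P th rho z j x xi I J = power_symb m L th rho z j y xi I J.
  move=> [rho0 H]; rewrite !mxE; congr (_ * _).
  apply: eq_contour_integral => [s rs|t]; apply: resE.
    by apply: ray; apply: le_trans rs; exact: ltW.
  (* An eigenvalue on the circle would have modulus rho, but all eigenvalues have larger modulus. *)
  by apply/negP => /H; rewrite norm_polar ?ltxx// ltW.
apply/funext => v; apply/propext.
split=> -[rho [U [F [rad HU FE dF vE]]]]; exists rho, U, F.
  apply: (And5 ((radE rho).1 rad) HU _ dF vE) => z z0.
  exact: (etrans (FE z z0) (powE rho z rad)).
have rad' := (radE rho).2 rad.
apply: (And5 rad' HU _ dF vE) => z z0.
exact: (etrans (FE z z0) (esym (powE rho z rad'))).
Qed.

(** Applying the matrix to the constant 1 selects the column of degree 0, and the top part selects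
    the row of degree n. *)
Lemma top_part_log_symb (P : local_op R n) th (x xi : E) :
  top_part (log_symb m P th n x xi *m const_one R n)
  = (enorm xi ^- n)%:C * xget 0 (log_entry m P th n x ((enorm xi)^-1 *: xi)
      (ix finset.setT) (ix finset.set0)).
Proof. by rewrite /top_part /const_one -colE !mxE. Qed.

(** The cone integral evaluates its integrand only at normalised non-zero vectors; the ellipticity
    condition speaks of xi != 0 only. *)
Lemma eq_sphere_integral (f g : E -> R) :
  (forall xi, xi != 0 -> f xi = g xi) -> sphere_integral f = sphere_integral g.
Proof.
move=> fg; congr (_ * integral_rV _); apply/funext => v.
case: ifP => // /andP[v0 _]; apply: fg.
apply: contraTneq v0 => /eqP; rewrite scaler_eq0 invr_eq0 => /orP[/eqP ->|/eqP ->].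
  by rewrite ltxx.
by rewrite enorm0 ltxx.
Qed.

Lemma eq_omega_res (P L : local_op R n) th (x y : E) :
  (forall xi, xi != 0 ->
     log_entry m P th n x xi (ix finset.setT) (ix finset.set0)
     = log_entry m L th n y xi (ix finset.setT) (ix finset.set0)) ->
  omega_res m P th x = omega_res m L th y.
Proof.
move=> PL; have E xi : xi != 0 ->
    top_part (log_symb m P th n x xi *m const_one R n)
    = top_part (log_symb m L th n y xi *m const_one R n).
  move=> xi0; have u0 : (enorm xi)^-1 *: xi != 0.
    rewrite scaler_eq0 negb_or xi0 andbT invr_neq0//.
    apply: contraNneq xi0 => e0; rewrite -normr_le0.
    by rewrite (le_trans (norm_le_enorm xi))// e0.
  apply: (etrans (top_part_log_symb P th x xi)).
  apply: (etrans _ (esym (top_part_log_symb L th y xi))).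
  exact: (congr1 (fun S => (enorm xi ^- n)%:C * xget 0 S) (PL _ u0)).
have ReE := eq_sphere_integral (fun xi xi0 => congr1 (@complex.Re R) (E xi xi0)).
have ImE := eq_sphere_integral (fun xi xi0 => congr1 (@complex.Im R) (E xi xi0)).
exact: (congr2 (fun s t : R => ((2 * pi) ^- n)%:C * (s +i* t)) ReE ImE).
Qed.

End Contour.

(** * Equality of the residue densities *)

Theorem theorem6p7 (R : realType) (n : nat)
    (X : closed_manifold R n) (g : riemannian_metric X) (p : X)
    (d : chart R n X) (e : 'M[R]_n) (r : R) (u : chart R n X)
    (a b : 'rV[R]_n -> 'M[R]_n)
    (m : nat) (P : diff_op X m) (theta : R) (Plim : local_op R n) :
  orthonormal_basis g d p e ->
  normal_chart g d p e r u ->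
  vielbeins g d p e r u a b ->
  (0 < m)%N ->
  geometric_op a b m (eball r) (coef P u) ->
  agmon_angle P theta ->
  rescaling_limit m (eball r) (coef P u) Plim ->
  forall x : 'rV[R]_n, eball r x ->
    omega_res m (coef P u) theta (to_coord u p) = omega_res m Plim theta x.
Proof.
move=> _ [r0 uX imgu [_ ->] _] _ _ _ [agm _] PL x Ux.
have Uo : open (@eball R n r) by rewrite -imgu; exact: img_open.
have sP : smooth_coefs m (eball r) (coef P u).
  by rewrite -imgu; exact: coef_smooth.
(* In the normal chart p has coordinate 0. It remains to compare the spectra through determinants,
   to keep the ray free of eigenvalues at 0 by the Agmon condition, and to match the resolvent
   entries off the spectrum. *)
apply: eq_omega_res => xi xi0; apply: eq_log_entry.
- by move=> mu; rewrite !eigenvalue_unitmx !unitmxE (det_symb0_limit r0 Uo sP PL _ _ Ux).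
- move=> s s0; apply: agm => //; rewrite imgu; exact: eball_0.
- move=> mu; rewrite eigenvalue_unitmx negbK.
  exact: (res_symb_limit r0 Uo sP PL Ux).
Qed.
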